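(* Let $NAE_3=\{0,1\}^3\setminus\{(0,0,0),(1,1,1)\}$ and let $N=\{(a,b,c)\in\{0,1,2\}^{3}\mid \{a,b,c\}\neq\{0,1,2\}\}$. Then $\mathrm{CSP}(\{NAE_3\})$ is polynomial-time reducible to $\mathrm{SCSP}(\{N\})$.
   Context: A constraint language on a finite set $A$ is a set $\Gamma$ of relations on $A$. An instance of $\mathrm{CSP}(\Gamma)$ is a formula $R_1(z_{1,1},\dots,z_{1,n_1})\wedge\dots\wedge R_s(z_{s,1},\dots,z_{s,n_s})$ with $R_i\in\Gamma$ and each $z_{i,j}$ among variables $x_1,\dots,x_n$; the question is whether it is satisfiable over $A$. An instance of $\mathrm{SCSP}(\Gamma)$ consists of a fixed finite set of variables $\{x_1,\dots,x_n\}$ (not all of which need occur in constraints) together with such a formula; the question is whether there is a satisfying assignment with $\{x_1,\dots,x_n\}=A$ as a set of values. *)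

(* Defs.v *)
From Stdlib Require Import BinNums BinNat.
From mathcomp Require Import all_boot.
Set Implicit Arguments. Unset Strict Implicit. Unset Printing Implicit Defensive.

Definition NAE3 : {set bool * bool * bool} :=
  ~: [set (false, false, false); (true, true, true)].

Definition Nrel : {set 'I_3 * 'I_3 * 'I_3} :=
  [set t | [set t.1.1; t.1.2; t.2] != [set: 'I_3]].

(* An instance of CSP({NAE3}): a list of constraints NAE3(x_i, x_j, x_k),
   each given by the triple of variable indices (i, j, k). *)
Definition csp_inst := seq (nat * nat * nat).

Definition csp_sat (I : csp_inst) : Prop :=
  exists f : nat -> bool,
    forall t, t \in I -> (f t.1.1, f t.1.2, f t.2) \in NAE3.

(* An instance of SCSP({N}): the number n of variables x_0..x_{n-1}
   together with a list of constraints N(x_i, x_j, x_k). *)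
Definition scsp_inst := (nat * seq (nat * nat * nat))%type.

Definition scsp_wf (J : scsp_inst) : bool :=
  all (fun t : nat * nat * nat => [&& t.1.1 < J.1, t.1.2 < J.1 & t.2 < J.1]) J.2.

Definition scsp_sat (J : scsp_inst) : Prop :=
  exists f : nat -> 'I_3,
    (forall a : 'I_3, exists2 i, i < J.1 & f i = a) /\
    (forall t, t \in J.2 -> (f t.1.1, f t.1.2, f t.2) \in Nrel).

(* Encodings of instances as words over {1,2,3} (1 = bit 0, 2 = bit 1,  *)
(* 3 = separator #); numbers are written in binary, LSB first.          *)

Fixpoint bin_pos (p : positive) : seq nat :=
  match p with
  | xH => [:: 2]
  | xO p' => 1 :: bin_pos p'
  | xI p' => 2 :: bin_pos p'
  end.

Definition bin (n : nat) : seq nat :=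
  match N.of_nat n with N0 => [::] | Npos p => bin_pos p end.

Definition sep := 3.

Definition enc_triple (t : nat * nat * nat) : seq nat :=
  bin t.1.1 ++ sep :: bin t.1.2 ++ sep :: bin t.2 ++ [:: sep].

Definition enc_csp (I : csp_inst) : seq nat := flatten (map enc_triple I).

Definition enc_scsp (J : scsp_inst) : seq nat :=
  bin J.1 ++ sep :: flatten (map enc_triple J.2).

Definition L_scsp (w : seq nat) : Prop :=
  exists J : scsp_inst, w = enc_scsp J /\ scsp_wf J /\ scsp_sat J.

(* Deterministic single-tape Turing machines (bi-infinite tape).        *)
(* Tape alphabet 'I_(k+4): 0 = blank, 1,2,3 = input symbols.            *)
(* States 'I_(q+1), start state 0; the machine halts when delta = None. *)

Inductive move := MoveL | MoveR | Stay.

Record TM := {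
  tm_k : nat;
  tm_q : nat;
  tm_delta : 'I_tm_q.+1 -> 'I_tm_k.+4 ->
             option ('I_tm_q.+1 * 'I_tm_k.+4 * move)
}.

Section TMsem.
Variable M : TM.
Notation Sym := 'I_(tm_k M).+4.
Notation St := 'I_(tm_q M).+1.

(* configuration: state, cells left of the head (nearest first),
   cells from the head rightwards; missing cells are blank *)
Definition config := (St * seq Sym * seq Sym)%type.

Definition blank : Sym := ord0.

Definition read (r : seq Sym) : Sym := head blank r.

Definition step (c : config) : config :=
  let: (q, l, r) := c in
  match tm_delta q (read r) with
  | None => c
  | Some (q', s, m) =>
      let r1 := s :: behead r in
      match m with
      | Stay => (q', l, r1)
      | MoveR => (q', s :: l, behead r)
      | MoveL => match l with
                 | [::] => (q', [::], blank :: r1)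
                 | a :: l' => (q', l', a :: r1)
                 end
      end
  end.

Definition halted (c : config) : bool :=
  let: (q, l, r) := c in
  if tm_delta q (read r) is None then true else false.

Definition init (w : seq nat) : config := (ord0, [::], map (fun x => inord x) w).

Fixpoint out_word (r : seq Sym) : seq nat :=
  match r with
  | [::] => [::]
  | a :: r' => if (1 <= a <= 3) then val a :: out_word r' else [::]
  end.

Definition computes_within (w : seq nat) (t : nat) (out : seq nat) : Prop :=
  exists2 s, s <= t &
    let c := iter s step (init w) in halted c /\ out_word c.2 = out.

End TMsem.

Definition csp_NAE3_poly_reducible_to_scsp_N : Prop :=
  exists (M : TM) (c d : nat),
    forall I : csp_inst, exists out : seq nat,
      computes_within M (enc_csp I) (c * (size (enc_csp I)).+1 ^ d) out /\
      (L_scsp out <-> csp_sat I).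

(* Main.v *)
From Stdlib Require Import BinNums BinPos BinNat Nnat Pnat.
Require Import Defs.
From HB Require Import structures.
From mathcomp Require Import all_boot.
From mathcomp Require Import zify.
Set Implicit Arguments. Unset Strict Implicit. Unset Printing Implicit Defensive.

(* Every occurrence of a variable with value h : bool becomes a block of SCSP variables standing for
   the functions of h listed in gad8; block 0 stands for the constants listed in con8. We constrain
   all triples of such functions of at most two occurrences that are never rainbow, whatever the
   values of these occurrences (or whenever the two values agree, if it is the same variable).
   In a surjective solution the constants 0, 1, 2 then get distinct colours: three variables of
   distinct colours lie in three blocks, and a finite search over these blocks and the constants
   succeeds. Once the constants are distinct, each block encodes a bit, and N restricted to the slots
   1|0, 0|2, 2|1 of three blocks is NAE3.

   The reduction is computed by a program on 11 stacks. The stacks are the tracks of one tape, with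
   their tops at its left end: the input word already is the first stack, and the output word is the
   first stack at the end, when all others are empty. *)

(** * The reduction *)

(** [N] is invariant under permutations of the colours, and every assignment with at most two
    colours satisfies every instance. So constraints alone can neither name a colour nor force a
    third one; only surjectivity does, and it does not tell which variables carry the three colours.
    The constraints must therefore transport a rainbow triple from anywhere to the constants. This
    is why they are imposed on all pairs of blocks and why a block contains every non-constant
    function of its bit. Taking all never-rainbow triples makes these constraints true under the
    intended assignment by construction, and what remains for soundness is a finite question about
    at most four blocks. Blocks belong to occurrences and not to variables because names of
    variables are arbitrary binary numbers: the number of a block is then a mere counter, and the
    machine only has to test two names for equality. *)

Definition rainbow (a b c : nat) : bool := [&& a != b, b != c & a != c].

Lemma in_Nrel (a b c : 'I_3) : ((a, b, c) \in Nrel) = ~~ rainbow a b c.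
Proof.
rewrite inE /= /rainbow; congr negb.
have -> : ([set a; b; c] == [set: 'I_3]) = (#|[set a; b; c]| == 3).
  have h3 : #|[set a; b; c]| <= 3 by rewrite -[leqRHS](card_ord 3) max_card.
  by rewrite eqEcard subsetT cardsT card_ord eqn_leq h3.
have -> : [set a; b; c] = c |: (b |: [set a]).
  by apply/setP=> x; rewrite !inE; case: (x == a); case: (x == b); case: (x == c).
rewrite !cardsU1 cards1 !inE (eq_sym c b) (eq_sym c a) (eq_sym b a) -!val_eqE /=.
by case: (nat_of_ord a == b); case: (nat_of_ord b == c); case: (nat_of_ord a == c).
Qed.

(* The pair (a, b) is the function mapping the bit false to a and true to b. *)
Definition con8 : seq (nat * nat) :=
  [:: (0,0); (1,1); (2,2); (0,0); (0,0); (0,0); (0,0); (0,0)].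
(** All six non-constant functions from a bit to the colours; slots 3 to 5 are slots 0 to 2 of the
    negated bit. Two copies of 0|1 pad the block to a power of two, so that in binary a variable is
    three low bits followed by the number of its block. *)
Definition gad8 : seq (nat * nat) :=
  [:: (0,1); (0,2); (1,2); (1,0); (2,0); (2,1); (0,1); (0,1)].

Definition bitval (p : nat * nat) (h : bool) : nat := if h then p.2 else p.1.

(* Slot [k] of a block whose bit is [h]; [c] says whether it is the block of constants. *)
Definition slotval (c : bool) (k : nat) (h : bool) : nat :=
  bitval (nth (0, 0) (if c then con8 else gad8) k) h.

(* In a template, block 0 holds the constants and blocks 1 and 2 are a pair of occurrences. *)
Definition vert := (nat * nat)%type.
Definition vval (h1 h2 : bool) (x : vert) : nat :=
  slotval (x.1 == 0) x.2 (if x.1 == 1 then h1 else h2).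

Definition never_rainbow (P : bool -> bool -> bool) (t : vert * vert * vert) : bool :=
  all (fun h1 => all (fun h2 => P h1 h2 ==>
    ~~ rainbow (vval h1 h2 t.1.1) (vval h1 h2 t.1.2) (vval h1 h2 t.2))
    [:: false; true]) [:: false; true].

Definition verts : seq vert := [seq (s, k) | s <- iota 0 3, k <- iota 0 8].

(* Opaque, so that unification never computes these large lists. *)
Fact template_subproof : {template : (bool -> bool -> bool) -> seq (vert * vert * vert) |
  forall P, template P = filter (never_rainbow P)
    [seq (p, z) | p <- [seq (x, y) | x <- verts, y <- verts], z <- verts]}.
Proof. by exists (fun P => filter (never_rainbow P)
    [seq (p, z) | p <- [seq (x, y) | x <- verts, y <- verts], z <- verts]). Qed.

Definition template := sval template_subproof.
Definition pair_template := template (fun _ _ => true).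
Definition eq_template := template (fun h1 h2 => h1 == h2).

Lemma mem_verts s k : ((s, k) \in verts) = (s < 3) && (k < 8).
Proof.
apply/allpairsP/andP => [[[a b] [+ + [-> ->]]]|[hs hk]].
  by rewrite !mem_iota.
by exists (s, k); split; rewrite ?mem_iota.
Qed.

Lemma mem_template P x y z :
  ((x, y, z) \in template P) =
  [&& x \in verts, y \in verts, z \in verts & never_rainbow P (x, y, z)].
Proof.
rewrite /template (svalP template_subproof) mem_filter andbC.
suff -> : ((x, y, z) \in [seq (p, z) | p <- [seq (x, y) | x <- verts, y <- verts], z <- verts]) =
    [&& x \in verts, y \in verts & z \in verts] by rewrite -!andbA.
apply/allpairsP/and3P => [[[[a b] c] [+ + [-> -> ->]]]|[hx hy hz]].
  by move=> /allpairsP[[a' b'] [? ? [-> ->]]] ?.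
by exists ((x, y), z); split=> //; apply/allpairsP; exists (x, y).
Qed.

Lemma never_rainbowP (P : bool -> bool -> bool) t : reflect
  (forall h1 h2, P h1 h2 -> ~~ rainbow (vval h1 h2 t.1.1) (vval h1 h2 t.1.2) (vval h1 h2 t.2))
  (never_rainbow P t).
Proof.
apply: (iffP allP) => [H h1 h2 hP|H h1 _].
  have /allP/(_ h2) : all (fun h2 => P h1 h2 ==>
    ~~ rainbow (vval h1 h2 t.1.1) (vval h1 h2 t.1.2) (vval h1 h2 t.2)) [:: false; true].
    by apply: H; case: (h1).
  by rewrite hP; apply; case: (h2).
by apply/allP=> h2 _; apply/implyP; apply: H.
Qed.

Definition place (u v : nat) (x : vert) : nat := 8 * nth 0 [:: 0; u; v] x.1 + x.2.
Definition place3 (u v : nat) (t : vert * vert * vert) : nat * nat * nat :=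
  (place u v t.1.1, place u v t.1.2, place u v t.2).

(* An item (b, a) is the b-th occurrence (counted from 1) and its variable a. *)
Definition pair_cons (p q : nat * nat) : seq (nat * nat * nat) :=
  map (place3 p.1 q.1) (pair_template ++ if p.2 == q.2 then eq_template else [::]).

Lemma pair_template_cons p q t : t \in pair_template -> place3 p.1 q.1 t \in pair_cons p q.
Proof. by move=> ht; apply: map_f; rewrite mem_cat ht. Qed.

Lemma eq_template_cons p q t : p.2 = q.2 -> t \in eq_template ->
  place3 p.1 q.1 t \in pair_cons p q.
Proof. by move=> e ht; apply: map_f; rewrite e eqxx mem_cat; apply/orP; right. Qed.

Definition occs (I : csp_inst) : seq nat := flatten [seq [:: t.1.1; t.1.2; t.2] | t <- I].

Definition items (I : csp_inst) : seq (nat * nat) :=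
  zip (iota 1 (size (occs I))) (occs I).

(** Slots 3, 1, 5 are 1|0, 0|2, 2|1. Three equal bits give the colours 1, 0, 2 or 0, 2, 1, and all
    other bits repeat a colour. The third occurrence comes first because the program pushes the
    vertices on its output. *)
Definition clause_con (b : nat) : nat * nat * nat :=
  (place b.+3 b (1, 5), place b.+2 b (1, 1), place b.+1 b (1, 3)).

Definition reduction_list (I : csp_inst) : seq (nat * nat * nat) :=
  [seq clause_con (3 * j) | j <- iota 0 (size I)] ++
  flatten [seq flatten [seq pair_cons p q | q <- items I] | p <- items I].

(** The output is built by pushing, so the constraint produced first ends up last: hence [rev]. *)
Definition reduction (I : csp_inst) : scsp_inst :=
  (8 * (size (occs I)).+1, rev (reduction_list I)).

Lemma size_occs I : size (occs I) = 3 * size I.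
Proof. by rewrite /occs; elim: I => //= t I ->; lia. Qed.

Lemma nth_occs I j t0 : j < size I ->
  [/\ nth 0 (occs I) (3 * j) = (nth t0 I j).1.1,
      nth 0 (occs I) (3 * j).+1 = (nth t0 I j).1.2 &
      nth 0 (occs I) (3 * j).+2 = (nth t0 I j).2].
Proof.
rewrite /occs; elim: I j => //= t I IH [|j] hj; first by split.
have -> : 3 * j.+1 = (3 * j).+3 by lia.
exact: IH.
Qed.

Lemma mem_items I b a : ((b, a) \in items I) = [&& 0 < b, b <= size (occs I) & a == nth 0 (occs I) b.-1].
Proof.
rewrite /items; set s := occs I.
have sz : size (iota 1 (size s)) = size s by rewrite size_iota.
apply/(nthP (0,0))/and3P => [[i]|[b0 bs /eqP ->]].
  rewrite size_zip size_iota minnn => hi; rewrite nth_zip // nth_iota // => -[<- <-].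
  by rewrite add1n.
exists b.-1; first by rewrite size_zip size_iota minnn; lia.
by rewrite nth_zip // nth_iota; [congr pair; lia | lia].
Qed.

Lemma mem_reduction I t :
  reflect ((exists2 j, j < size I & t = clause_con (3 * j)) \/
    exists p q, [/\ p \in items I, q \in items I & t \in pair_cons p q])
   (t \in (reduction I).2).
Proof.
rewrite mem_rev mem_cat.
apply: (iffP orP) => -[].
- by case/mapP=> j; rewrite mem_iota => hj ->; left; exists j.
- case/flatten_mapP=> p hp /flatten_mapP[q hq ht]; right; by exists p, q.
- by case=> j hj ->; left; apply/map_f; rewrite mem_iota.
case=> p [q [hp hq ht]]; right; apply/flatten_mapP; exists p => //.
by apply/flatten_mapP; exists q.
Qed.

Lemma place_lt n u v x : x \in verts -> u <= n -> v <= n -> place u v x < 8 * n.+1.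
Proof.
by case: x => s k; rewrite mem_verts /place /= => /andP[+ hk] hu hv;
  case: s => [|[|[|s]]] //= _; lia.
Qed.

Lemma template_verts P t : t \in template P -> [/\ t.1.1 \in verts, t.1.2 \in verts & t.2 \in verts].
Proof. by case: t => [[x y] z]; rewrite mem_template => /and4P[]. Qed.

Lemma pair_template_verts t :
  t \in pair_template -> [/\ t.1.1 \in verts, t.1.2 \in verts & t.2 \in verts].
Proof. exact: template_verts. Qed.

Lemma eq_template_verts t :
  t \in eq_template -> [/\ t.1.1 \in verts, t.1.2 \in verts & t.2 \in verts].
Proof. exact: template_verts. Qed.

Lemma reduction_wf I : scsp_wf (reduction I).
Proof.
apply/allP=> t /mem_reduction[[j hj ->]|[[u a] [[v b] [hp hq]]]].
  have := size_occs I; rewrite /clause_con /place /= => hs; apply/and3P; split; lia.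
move: hp hq; rewrite !mem_items => /and3P[_ hu _] /and3P[_ hv _].
case/mapP=> t' ht ->.
have [h1 h2 h3] : [/\ t'.1.1 \in verts, t'.1.2 \in verts & t'.2 \in verts].
  move: ht; rewrite mem_cat => /orP[/pair_template_verts//|].
  by case: ifP => // _ /eq_template_verts.
by rewrite /= !place_lt.
Qed.

(** The intended solution. Occurrences are counted from 1; in block 0 the predecessor is a dummy,
    since constants ignore the bit. *)
Definition colour (I : csp_inst) (h : nat -> bool) (i : nat) : 'I_3 :=
  inord (slotval (i %/ 8 == 0) (i %% 8) (h (nth 0 (occs I) (i %/ 8).-1))).

Lemma slotval_lt c k h : slotval c k h < 3.
Proof. by case: c; case: h; do 9?[case: k => [|k] //]. Qed.

Lemma slotval_const k h h' : slotval true k h = slotval true k h'.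
Proof. by rewrite /slotval; do 9?[case: k => [|k]; first by case: h; case: h']; case: h; case: h'. Qed.

Lemma val_colour I h u v x : x \in verts -> 0 < u -> 0 < v ->
  colour I h (place u v x) = vval (h (nth 0 (occs I) u.-1)) (h (nth 0 (occs I) v.-1)) x :> nat.
Proof.
case: x => s k; rewrite mem_verts => /andP[hs hk] hu hv.
rewrite /colour inordK ?slotval_lt // /place mulnC divnMDl // modnMDl /=.
rewrite divn_small // modn_small // addn0 /vval /=.
case: s hs => [|[|[|s]]] //= _; first exact: slotval_const.
  by rewrite eqn0Ngt hu.
by rewrite eqn0Ngt hv.
Qed.

Lemma reduction_complete I : csp_sat I -> scsp_sat (reduction I).
Proof.
case=> h hh; exists (colour I h); split=> [a|t].
  (* Variable [a] is the slot of block 0 that holds the constant [a]. *)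
  exists a; first by case: a => a /= ha; lia.
  apply/val_inj; case: a => -[|[|[|a]]] // ?; rewrite /= inordK ?slotval_lt //; by case: (h _).
case/mem_reduction=> [[j hj ->]|[[u a] [[v b] [hp hq ht]]]].
  have [e1 e2 e3] := nth_occs (0,0,0) hj.
  have := hh _ (mem_nth (0,0,0) hj).
  rewrite in_Nrel /clause_con /=.
  set t0 := nth _ I j; rewrite -/t0 in e1 e2 e3.
  have hv k : k < 8 -> (1, k) \in verts by move=> hk; rewrite mem_verts.
  have cc b k : k < 8 -> 0 < b -> colour I h (place b (3*j) (1, k)) =
     slotval false k (h (nth 0 (occs I) b.-1)) :> nat.
    (* [val_colour] asks for two positive block numbers, but [3 * j] may be 0. A vertex of block 1
       does not depend on the second number. *)
    move=> hk hb; have -> : place b (3 * j) (1, k) = place b b (1, k) by [].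
    by rewrite val_colour ?hv.
  rewrite !cc //= e1 e2 e3.
  by case: (h _); case: (h _); case: (h _); rewrite ?inE.
move: hp hq; rewrite !mem_items => /and3P[hu _ /eqP ea] /and3P[hv _ /eqP eb].
case/mapP: ht => -[[x y] z] ht ->; rewrite in_Nrel.
have [hx hy hz] : [/\ x \in verts, y \in verts & z \in verts].
  move: ht; rewrite mem_cat => /orP[/pair_template_verts//|].
  by case: ifP => // _ /eq_template_verts.
rewrite /= !val_colour // -ea -eb.
move: ht; rewrite mem_cat mem_template => /orP[/and4P[_ _ _ /never_rainbowP]|].
  by apply.
case: eqP => //= ab; rewrite mem_template => /and4P[_ _ _ /never_rainbowP]; apply.
by rewrite ab.
Qed.

(** * Recovering the constants *)

Definition gadval (i : nat) (h : bool) : nat := bitval (nth (0, 0) [:: (0,1); (0,2); (1,2)] i) h.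

(* In the search, block 0 holds the constants 0, 1, 2, and a block [b > 0] the functions 0|1, 0|2, 1|2. *)
Definition lval (h1 h2 : bool) (x : vert) : nat :=
  match x.1 with 0 => x.2 | 1 => gadval x.2 h1 | _ => gadval x.2 h2 end.

Definition lfree (x y z : vert) : bool :=
  all (fun h1 => all (fun h2 => ~~ rainbow (lval h1 h2 x) (lval h1 h2 y) (lval h1 h2 z))
    [:: false; true]) [:: false; true].

Lemma lfreeP x y z : lfree x y z ->
  forall h1 h2, ~~ rainbow (lval h1 h2 x) (lval h1 h2 y) (lval h1 h2 z).
Proof. by rewrite /lfree /= !andbT => /andP[/andP[? ?] /andP[? ?]] [] []. Qed.

Definition relabel (p : nat * nat) (s : nat) : nat :=
  if s == 0 then 0 else if s == p.1 then 1 else if s == p.2 then 2 else 3.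

Definition relv p (x : vert) : vert := (relabel p x.1, x.2).

(** Blocks 1, 2, 3 stand for three blocks of the instance, but a constraint involves only two of
    them besides the constants. [relabel] returns 3 for the block outside the pair, which fails the
    test. *)
Definition lcon (x y z : vert) : bool :=
  has (fun p => [&& relabel p x.1 < 3, relabel p y.1 < 3, relabel p z.1 < 3 &
    lfree (relv p x) (relv p y) (relv p z)]) [:: (1, 2); (1, 3); (2, 3)].

(** * Exhaustive search and its soundness *)

Section Search.
Variables (con : vert -> vert -> vert -> bool) (dom : seq vert) (P : (vert -> nat) -> bool).
Variable g : vert -> nat.
Hypothesis g_lt : forall x, g x < 3.
Hypothesis P_ext : forall g1 g2, {in dom, g1 =1 g2} -> P g1 = P g2.

Fixpoint conflict (asg : seq (vert * nat)) (v : vert) (c : nat) : bool :=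
  if asg is a :: asg' then
    if has (fun b => if rainbow a.2 b.2 c then con a.1 b.1 v else false) asg' then true
    else conflict asg' v c
  else false.

Lemma conflictP asg v c : conflict asg v c ->
  exists a b, [/\ a \in asg, b \in asg, rainbow a.2 b.2 c & con a.1 b.1 v].
Proof.
elim: asg => //= a asg IH; case: ifP => [/hasP[b hb] + _|_ /IH[a' [b [ha hb hr hl]]]].
  by case: ifP => // hr hl; exists a, b; rewrite mem_head inE hb orbT.
by exists a', b; rewrite !inE ha hb !orbT.
Qed.

(** The default 3 is no colour and marks a vertex without assigned value. *)
Fixpoint look (asg : seq (vert * nat)) (v : vert) : nat :=
  if asg is (w, c) :: asg' then if v == w then c else look asg' v else 3.

Definition decided (asg : seq (vert * nat)) : bool :=
  if all (fun v => look asg v < 3) dom then P (look asg) else false.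

(* [if] instead of [||] keeps call-by-value evaluation from exploring pruned branches *)
Fixpoint search (ord : seq vert) (asg : seq (vert * nat)) : bool :=
  if decided asg then true else
  if ord is v :: ord' then
    all (fun c => if conflict asg v c then true else search ord' ((v, c) :: asg)) [:: 0; 1; 2]
  else false.

Lemma lookP asg v : all (fun a => g a.1 == a.2) asg -> look asg v < 3 -> look asg v = g v.
Proof.
elim: asg => //= -[w c] asg IH /andP[/eqP hw ha].
by case: eqP => [->//|_]; exact: IH.
Qed.

Lemma decidedP asg : all (fun a => g a.1 == a.2) asg -> decided asg -> P g.
Proof.
move=> ha; rewrite /decided; case: ifP => // /allP hd.
by rewrite (@P_ext _ g) // => v /hd /(lookP ha).
Qed.

(** One branch of the search gives every vertex its colour under [g]. No conflict can prune it,
    because [g] satisfies the constraints; so it ends in a decided node, where the partial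
    assignment agrees with [g] on [dom] and certifies [P g]. *)
Lemma searchP ord asg :
  {in ord ++ map fst asg & &, forall x y z, con x y z -> ~~ rainbow (g x) (g y) (g z)} ->
  all (fun a => g a.1 == a.2) asg -> search ord asg -> P g.
Proof.
elim: ord asg => [|v ord IH] asg hc ha.
  by rewrite /=; case: ifP => // /(decidedP ha).
have -> : search (v :: ord) asg = if decided asg then true else
  all (fun c => if conflict asg v c then true else search ord ((v, c) :: asg)) [:: 0; 1; 2] by [].
case: ifP => [/(decidedP ha) //|_ /allP /(_ (g v)) hs].
have {hs} : if conflict asg v (g v) then true else search ord ((v, g v) :: asg).
  by apply: hs; move: (g_lt v); case: (g v) => [|[|[|]]].
case: ifP => [/conflictP[a [b [ina inb hr hl]]]|_].
  move/allP: ha => ha.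
  have := hc a.1 b.1 v; rewrite !inE !mem_cat eqxx /= !(map_f fst) ?orbT // (eqP (ha _ ina)) (eqP (ha _ inb)) hr.
  by move=> /(_ isT isT isT hl).
apply: IH => /=; last by rewrite eqxx.
by move=> x y z hx hy hz; apply: hc; [move: hx|move: hy|move: hz]; rewrite !(inE, mem_cat) orbCA orbA.
Qed.

End Search.

Definition consts : seq vert := [:: (0, 0); (0, 1); (0, 2)].
Definition const_rainbow (g : vert -> nat) : bool := rainbow (g (0, 0)) (g (0, 1)) (g (0, 2)).

(** The constants come early because a branch is decided as soon as they are rainbow. The three
    vertices coloured by [start] are left out. *)
Definition search_order (i j k : nat) : seq vert :=
 filter (fun v => v \notin [:: (1, i); (2, j); (3, k)])
  [:: (0,0); (0,1); (0,2); (1,0); (1,1); (1,2); (2,0); (2,1); (2,2); (3,0); (3,1); (3,2)].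

Definition start (c1 c2 c3 i j k : nat) : seq (vert * nat) := [:: ((1, i), c1); ((2, j), c2); ((3, k), c3)].

Definition all3 (P : nat -> bool) := all P [:: 0; 1; 2].

Lemma all3P (P : nat -> bool) : reflect (forall i, i < 3 -> P i) (all3 P).
Proof.
apply: (iffP allP) => [H [|[|[|i]]] // _|H [|[|[|i]]] // _]; apply: H => //.
Qed.

(** The finite core of soundness: for each of the 27 choices of one slot per view and the 6 rainbow
    colourings of these slots, every extension that violates no constraint makes the constants
    rainbow. *)
Lemma search_succeeds :
  all3 (fun i => all3 (fun j => all3 (fun k => all3 (fun a => all3 (fun b => all3 (fun c =>
  if rainbow a b c then search lcon consts const_rainbow (search_order i j k) (start a b c i j k) else true)))))).
Proof. by vm_compute. Qed.

Lemma three_views g : (forall x, g x < 3) ->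
  (forall x y z, x.2 < 3 -> y.2 < 3 -> z.2 < 3 -> lcon x y z -> ~~ rainbow (g x) (g y) (g z)) ->
  forall i j k, i < 3 -> j < 3 -> k < 3 -> rainbow (g (1, i)) (g (2, j)) (g (3, k)) ->
  rainbow (g (0, 0)) (g (0, 1)) (g (0, 2)).
Proof.
move=> gl gc i j k hi hj hk hr.
have /all3P/(_ i hi)/all3P/(_ j hj)/all3P/(_ k hk) := search_succeeds.
move=> /all3P/(_ _ (gl (1, i)))/all3P/(_ _ (gl (2, j)))/all3P/(_ _ (gl (3, k))).
rewrite hr; apply: (searchP gl); last by rewrite /= !eqxx.
  by move=> g1 g2 e; rewrite /const_rainbow !e.
have small : {in search_order i j k ++ map fst (start (g (1, i)) (g (2, j)) (g (3, k)) i j k),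
    forall v, v.2 < 3}.
  move=> v; rewrite mem_cat mem_filter => /orP[/andP[_]|]; first by apply/allP: v.
  by rewrite /= !inE => /or3P[] /eqP ->.
by move=> x y z /small hx /small hy /small hz; exact: gc.
Qed.

(* Three slots, containing slot [k], that behave as 0|1, 0|2, 1|2 for the bit [view_bit]; duplicated
   slots and constants need no separate treatment this way. *)
Definition view (c : bool) (k : nat) : seq nat :=
  if c then (if k == 2 then [:: 1; 2; 2] else if k == 1 then [:: 0; 0; 1] else [:: k; k; 1])
  else nth [::] [:: [:: 0; 1; 2]; [:: 0; 1; 2]; [:: 0; 1; 2]; [:: 3; 4; 5]; [:: 3; 4; 5];
    [:: 3; 4; 5]; [:: 6; 1; 2]; [:: 7; 1; 2]] k.

Definition view_bit (c : bool) (k : nat) (h : bool) : bool :=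
  if c then k == 2 else h (+) (k \in [:: 3; 4; 5]).

Definition view_pos (c : bool) (k : nat) : nat := index k (view c k).

Lemma viewP c k h i : k < 8 -> i < 3 ->
  slotval c (nth 0 (view c k) i) h = gadval i (view_bit c k h).
Proof.
by case: c; case: h; do 8?[case: k => [|k] //]; do 3?[case: i => [|i] //].
Qed.

Lemma view_lt c k i : k < 8 -> i < 3 -> nth 0 (view c k) i < 8.
Proof. by case: c; do 8?[case: k => [|k] //]; do 3?[case: i => [|i] //]. Qed.

Lemma view_posP c k : k < 8 -> view_pos c k < 3 /\ nth 0 (view c k) (view_pos c k) = k.
Proof. by case: c; do 8?[case: k => [|k] //]. Qed.

Definition block_verts : seq vert := [seq (1, k) | k <- iota 0 8].

(** Slot 0 is 0|1, so it shares the colour of the constant 1 exactly if the bit is true. Colours are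
    compared with those of the constants because a solution may permute the three colours. *)
Definition decode (g : vert -> nat) : bool :=
  all (fun k => g (1, k) == g (0, slotval false k (g (1, 0) == g (0, 1)))) (iota 0 8).

Definition block_con (x y z : vert) : bool := never_rainbow (fun _ _ => true) (x, y, z).

Lemma decode_search : all3 (fun a => all3 (fun b => all3 (fun c => if rainbow a b c then
  search block_con (consts ++ block_verts) decode block_verts
    [:: ((0, 0), a); ((0, 1), b); ((0, 2), c)] else true))).
Proof. by vm_compute. Qed.

Lemma decode_block g : (forall x, g x < 3) ->
  {in consts ++ block_verts & &, forall x y z, block_con x y z -> ~~ rainbow (g x) (g y) (g z)} ->
  const_rainbow g -> decode g.
Proof.
move=> gl gc hr; have := decode_search.
move=> /all3P/(_ _ (gl (0, 0)))/all3P/(_ _ (gl (0, 1)))/all3P/(_ _ (gl (0, 2))).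
rewrite -/(const_rainbow g) hr; apply: (searchP gl); last by rewrite /= !eqxx.
  move=> g1 g2 e; apply: eq_in_all => k hk.
  have hv : (1, k) \in consts ++ block_verts by rewrite mem_cat (map_f (pair 1)) ?orbT.
  rewrite (e _ hv) (e (1, 0)) // (e (0, 1)) // e // mem_cat.
  by have := slotval_lt false k (g2 (1, 0) == g2 (0, 1)); case: slotval => [|[|[|]]].
by move=> x y z hx hy hz; apply: gc; [move: hx|move: hy|move: hz]; rewrite !mem_cat orbC.
Qed.

(** * Soundness of the reduction *)

Section Sound.
Variables (I : csp_inst) (f : nat -> 'I_3).
Let M := size (occs I).
Hypothesis f_con : forall t, t \in (reduction I).2 -> (f t.1.1, f t.1.2, f t.2) \in Nrel.

Definition in_block (b : nat) : bool := (0 < b) && (b <= M).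

Lemma pair_template_sat u v x y z : in_block u -> in_block v ->
  x \in verts -> y \in verts -> z \in verts -> never_rainbow (fun _ _ => true) (x, y, z) ->
  ~~ rainbow (f (place u v x)) (f (place u v y)) (f (place u v z)).
Proof.
move=> /andP[u0 uM] /andP[v0 vM] hx hy hz ht; rewrite -in_Nrel.
apply: (f_con (t := place3 u v (x, y, z))); apply/mem_reduction; right.
exists (u, nth 0 (occs I) u.-1), (v, nth 0 (occs I) v.-1); rewrite !mem_items u0 uM v0 vM !eqxx.
split; [by [] | by [] | apply: (pair_template_cons (_, _) (_, _))].
by rewrite mem_template hx hy hz.
Qed.

Lemma eq_template_sat u v x y z : in_block u -> in_block v ->
  nth 0 (occs I) u.-1 = nth 0 (occs I) v.-1 ->
  x \in verts -> y \in verts -> z \in verts -> never_rainbow (fun h1 h2 => h1 == h2) (x, y, z) ->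
  ~~ rainbow (f (place u v x)) (f (place u v y)) (f (place u v z)).
Proof.
move=> /andP[u0 uM] /andP[v0 vM] e hx hy hz ht; rewrite -in_Nrel.
apply: (f_con (t := place3 u v (x, y, z))); apply/mem_reduction; right.
exists (u, nth 0 (occs I) u.-1), (v, nth 0 (occs I) v.-1); rewrite !mem_items u0 uM v0 vM !eqxx.
split; [by [] | by [] | apply: (@eq_template_cons (_, _) (_, _)) => //].
by rewrite mem_template hx hy hz.
Qed.

Lemma clause_sat j : j < size I ->
  ~~ rainbow (f (8 * (3 * j).+3 + 5)) (f (8 * (3 * j).+2 + 1)) (f (8 * (3 * j).+1 + 3)).
Proof.
move=> hj; rewrite -in_Nrel; apply: (f_con (t := clause_con (3 * j))).
by apply/mem_reduction; left; exists j.
Qed.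

Hypothesis M_gt0 : 0 < M.

Definition view_vert (b k i : nat) : nat := 8 * b + nth 0 (view (b == 0) k) i.

Definition loc (b1 k1 b2 k2 : nat) (x : vert) : nat :=
  match x.1 with 0 => x.2 | 1 => view_vert b1 k1 x.2 | _ => view_vert b2 k2 x.2 end.

(** The bits of the views are functions of the bits of the blocks, so [lfree], which covers all
    values of the former, yields an instance of [pair_template]. The two blocks may coincide, and a
    view of block 0 behaves like that of a block with a fixed bit. *)
Lemma two_views b1 k1 b2 k2 x y z :
  b1 <= M -> b2 <= M -> k1 < 8 -> k2 < 8 ->
  x.1 < 3 -> y.1 < 3 -> z.1 < 3 -> x.2 < 3 -> y.2 < 3 -> z.2 < 3 -> lfree x y z ->
  ~~ rainbow (f (loc b1 k1 b2 k2 x)) (f (loc b1 k1 b2 k2 y)) (f (loc b1 k1 b2 k2 z)).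
Proof.
move=> hb1 hb2 hk1 hk2 hx hy hz hx' hy' hz' hf.
(* Constraints come from pairs of occurrences only. For a view of the constants, block 1, which
   exists by [M_gt0], completes the pair, and [r] sends the view to block 0 of the template. *)
pose u := if b1 == 0 then 1 else b1; pose v := if b2 == 0 then 1 else b2.
pose r (x : vert) : vert := match x.1 with
  | 0 => x
  | 1 => (if b1 == 0 then 0 else 1, nth 0 (view (b1 == 0) k1) x.2)
  | _ => (if b2 == 0 then 0 else 2, nth 0 (view (b2 == 0) k2) x.2) end.
have hu : in_block u by rewrite /in_block /u; case: eqP; lia.
have hv : in_block v by rewrite /in_block /v; case: eqP; lia.
have rP (w : vert) : w.1 < 3 -> w.2 < 3 -> r w \in verts /\ loc b1 k1 b2 k2 w = place u v (r w).
  case: w => [[|[|[|s]]] i] //= _ hi; rewrite /r /loc /place /view_vert /u /v /=.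
  - by rewrite mem_verts; split => //; lia.
  - split; first by rewrite mem_verts view_lt // andbT; case: eqP.
    by case: eqP => [->|_] /=.
  - split; first by rewrite mem_verts view_lt // andbT; case: eqP.
    by case: eqP => [->|_] /=.
have rV h1 h2 (w : vert) : w.1 < 3 -> w.2 < 3 ->
    vval h1 h2 (r w) = lval (view_bit (b1 == 0) k1 h1) (view_bit (b2 == 0) k2 h2) w.
  case: w => [[|[|[|s]]] i] //= _ hi; rewrite /r /vval /lval /=.
  - by rewrite (slotval_const _ _ true); case: i hi => [|[|[|i]]].
  - rewrite -(viewP _ h1) //; case: ifP => // _; exact: slotval_const.
  - rewrite -(viewP _ h2) //; case: ifP => // _; exact: slotval_const.
have [rx ->] := rP _ hx hx'; have [ry ->] := rP _ hy hy'; have [rz ->] := rP _ hz hz'.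
apply: pair_template_sat => //; apply/never_rainbowP => h1 h2 _; rewrite /= !rV //.
exact: lfreeP.
Qed.

Lemma consts_rainbow i0 i1 i2 : i0 < 8 * M.+1 -> i1 < 8 * M.+1 -> i2 < 8 * M.+1 ->
  rainbow (f i0) (f i1) (f i2) -> rainbow (f 0) (f 1) (f 2).
Proof.
move=> h0 h1 h2 hr.
(* Block and slot of each of the three variables. The blocks need not be distinct; entry 0 only
   aligns the list with the labels 1, 2, 3 of the search. *)
pose bk s := nth (0, 0) [:: (0, 0); (i0 %/ 8, i0 %% 8); (i1 %/ 8, i1 %% 8); (i2 %/ 8, i2 %% 8)] s.
have bkM s : (bk s).1 <= M.
  by rewrite /bk; case: s => [|[|[|[|s]]]] //=; rewrite ?nth_nil //; lia.
have bk8 s : (bk s).2 < 8.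
  by rewrite /bk; case: s => [|[|[|[|s]]]] //=; rewrite ?nth_nil ?ltn_pmod.
pose g (x : vert) : nat :=
  if x.1 == 0 then f x.2 else f (view_vert (bk x.1).1 (bk x.1).2 x.2).
have gl x : g x < 3 by rewrite /g; case: ifP => _; apply: ltn_ord.
have gc x y z : x.2 < 3 -> y.2 < 3 -> z.2 < 3 -> lcon x y z -> ~~ rainbow (g x) (g y) (g z).
  move=> hx hy hz /hasP[[p q] hp /and4P[rx ry rz hf]].
  have gE (w : vert) : relabel (p, q) w.1 < 3 ->
      g w = f (loc (bk p).1 (bk p).2 (bk q).1 (bk q).2 (relv (p, q) w)).
    rewrite /g /loc /relv /relabel /=; case: eqP => //= _.
    by case: eqP => [->|_] //=; case: eqP => [->|_].
  by rewrite !gE //; apply: two_views.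
have pos i : i < 8 * M.+1 -> view_vert (i %/ 8) (i %% 8) (view_pos (i %/ 8 == 0) (i %% 8)) = i
    /\ view_pos (i %/ 8 == 0) (i %% 8) < 3.
  move=> hi; have [|l e] := @view_posP (i %/ 8 == 0) (i %% 8); first by rewrite ltn_pmod.
  by rewrite /view_vert e; split=> //; lia.
have [e0 l0] := pos _ h0; have [e1 l1] := pos _ h1; have [e2 l2] := pos _ h2.
by apply: (three_views gl gc l0 l1 l2); rewrite /g /= e0 e1 e2.
Qed.

Definition bit (u : nat) : bool := f (8 * u) == f 1.

Lemma decode_bit u k : rainbow (f 0) (f 1) (f 2) -> in_block u -> k < 8 ->
  f (8 * u + k) = f (slotval false k (bit u)).
Proof.
move=> hr hu hk; pose g (x : vert) : nat := f (place u u x).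
have gl x : g x < 3 by apply: ltn_ord.
have : decode g.
  apply: (decode_block gl) => //.
  have sub : {subset consts ++ block_verts <= verts} by apply/allP.
  by move=> x y z hx hy hz hb; apply: pair_template_sat => //; apply: sub.
have hk' : k \in iota 0 8 by rewrite mem_iota.
move=> /allP/(_ k hk')/eqP; rewrite /g /place /= addn0 => /val_inj ->.
by rewrite /bit val_eqE.
Qed.

Lemma decode_sat : rainbow (f 0) (f 1) (f 2) -> csp_sat I.
Proof.
move=> hr; pose h a := bit (index a (occs I)).+1.
have eq_bit u v : in_block u -> in_block v -> nth 0 (occs I) u.-1 = nth 0 (occs I) v.-1 ->
    bit u -> bit v.
  move=> hu hv e bu; apply/negPn/negP => /negbTE bv.
  (* For equal bits, 0|1 of one block, 1|2 of the other and the constant 1 have the colours 0, 1, 1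
     or 1, 2, 1, so the triple is in the template. Bit false in [v] and true in [u] would give 0, 2,
     1, a rainbow. *)
  have := @eq_template_sat v u (1, 0) (2, 2) (0, 1) hv hu (esym e).
  rewrite !mem_verts => /(_ isT isT isT).
  have -> : never_rainbow (fun h1 h2 => h1 == h2) (1, 0, (2, 2), (0, 1)) by vm_compute.
  rewrite [place _ _ (0, 1)]/(0 * 8 + 1) [place _ _ (1, 0)]/(8 * v + 0) [place _ _ (2, 2)]/(8 * u + 2).
  rewrite !decode_bit // bu bv => /(_ isT); move: hr.
  rewrite /rainbow /slotval /=.
  by move=> /and3P[h01 h12 h02]; rewrite h02 h01 /= eq_sym h12.
have hE u : in_block u -> bit u = h (nth 0 (occs I) u.-1).
  move=> hu; have /andP[u0 uM] := hu.
  have hm : nth 0 (occs I) u.-1 \in occs I by apply: mem_nth; rewrite -/M; lia.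
  have hi : in_block (index (nth 0 (occs I) u.-1) (occs I)).+1 by rewrite /in_block /= -/M index_mem.
  by apply/idP/idP; apply: eq_bit => //=; rewrite nth_index.
exists h => t /(nthP (0,0,0))[j hj <-].
have [e1 e2 e3] := nth_occs (0,0,0) hj.
have sz := size_occs I.
have b3 : in_block (3 * j).+3.
  by rewrite /in_block /M sz /= -addn3 addnC -mulnS leq_mul2l.
have b2 : in_block (3 * j).+2 by rewrite /in_block /= ltnW.
have b1 : in_block (3 * j).+1 by rewrite /in_block /= ltnW.
have := clause_sat hj; rewrite !decode_bit // !hE // [(_.+3).-1]/= [(_.+2).-1]/= [(_.+1).-1]/= e1 e2 e3.
by case: (h _); case: (h _); case: (h _); rewrite !inE //=; move: hr; rewrite /rainbow; lia.
Qed.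

End Sound.

Theorem reduction_sound I : scsp_sat (reduction I) -> csp_sat I.
Proof.
case=> f [surj fc]; case: (posnP (size (occs I))) => [|M0].
  (* Without clauses there is no block to pair with the constants, but such an instance is
     satisfiable anyway. *)
  rewrite size_occs; case: I surj fc => // _ _ _; by exists xpredT.
have [i0 h0 e0] := surj (@Ordinal 3 0 isT).
have [i1 h1 e1] := surj (@Ordinal 3 1 isT).
have [i2 h2 e2] := surj (@Ordinal 3 2 isT).
apply: (decode_sat fc M0); apply: (consts_rainbow fc M0 h0 h1 h2).
by rewrite e0 e1 e2.
Qed.

(** * Turing machines over arbitrary finite alphabets *)

Definition sym := option bool.

Definition code_sym (a : sym) : nat :=
  match a with Some false => 1 | Some true => 2 | None => 3 end.

Section AbstractTM.
Variables (Q S : finType) (q0 : Q) (bl : S) (inp : sym -> S).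
Variable delta : Q -> S -> option (Q * S * move).
Hypothesis inp_inj : injective inp.
Hypothesis inp_bl : forall a, inp a != bl.

Definition aconfig := (Q * seq S * seq S)%type.

Definition astep (c : aconfig) : aconfig :=
  let: (q, l, r) := c in
  match delta q (head bl r) with
  | None => c
  | Some (q', s, m) =>
      let r1 := s :: behead r in
      match m with
      | Stay => (q', l, r1)
      | MoveR => (q', s :: l, behead r)
      | MoveL => match l with
                 | [::] => (q', [::], bl :: r1)
                 | a :: l' => (q', l', a :: r1)
                 end
      end
  end.

(** [TM] fixes 0 as start state and 0 to 3 as blank and input symbols. These numbers are reserved
    and the other elements are numbered above them by rank, wherever the enumeration puts the
    special ones. *)
Definition enc_state (q : Q) : 'I_#|Q|.+1 := if q == q0 then ord0 else inord (enum_rank q).+1.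
Definition dec_state (i : 'I_#|Q|.+1) : Q := if i == ord0 then q0 else nth q0 (enum Q) i.-1.

Lemma enc_stateK : cancel enc_state dec_state.
Proof.
move=> q; rewrite /enc_state /dec_state; case: (q =P q0) => [->|_]; first by rewrite eqxx.
have h : (enum_rank q).+1 < #|Q|.+1 by rewrite ltnS.
rewrite -val_eqE /= inordK //=.
by rewrite nth_enum_rank.
Qed.

Definition enc_sym (x : S) : 'I_#|S|.+4 :=
  if x == bl then inord 0 else if x == inp (Some false) then inord 1 else
  if x == inp (Some true) then inord 2 else if x == inp None then inord 3 else
  inord (enum_rank x).+4.
Definition dec_sym (i : 'I_#|S|.+4) : S :=
  match val i with
  | 0 => bl | 1 => inp (Some false) | 2 => inp (Some true) | 3 => inp None
  | k.+4 => nth bl (enum S) k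
  end.

Lemma enc_symK : cancel enc_sym dec_sym.
Proof.
move=> x; rewrite /enc_sym /dec_sym.
do 4![case: eqP => [->|_]; first by rewrite /= inordK].
have h : (enum_rank x).+4 < #|S|.+4 by rewrite !ltnS.
by rewrite /= inordK //= nth_enum_rank.
Qed.

Lemma enc_sym_inp a : enc_sym (inp a) = code_sym a :> nat.
Proof.
rewrite /enc_sym (negbTE (inp_bl a)) !(inj_eq inp_inj).
by case: a => [[]|] /=; rewrite inordK.
Qed.

Lemma enc_sym_bl : enc_sym bl = ord0.
Proof. by rewrite /enc_sym eqxx; apply/val_inj; rewrite /= inordK. Qed.

Definition tm_of : TM := {|
  tm_k := #|S|; tm_q := #|Q|;
  tm_delta := fun q s =>
    if delta (dec_state q) (dec_sym s) is Some (q', s', m)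
    then Some (enc_state q', enc_sym s', m) else None |}.

Definition enc_config (c : aconfig) : config tm_of :=
  let: (q, l, r) := c in (enc_state q, map enc_sym l, map enc_sym r).

Lemma read_map (r : seq S) : @read tm_of (map enc_sym r) = enc_sym (head bl r).
Proof. by case: r => //=; rewrite /read /= enc_sym_bl. Qed.

Lemma step_enc c : step (enc_config c) = enc_config (astep c).
Proof.
case: c => [[q l] r]; rewrite /= read_map enc_stateK enc_symK.
case: delta => [[[q' s] [] ]|] //=; rewrite -?behead_map //.
by case: l => [|a l] /=; rewrite ?enc_sym_bl behead_map.
Qed.

Lemma iter_step_enc n c : iter n (@step tm_of) (enc_config c) = enc_config (iter n astep c).
Proof. by elim: n => //= n ->; rewrite step_enc. Qed.

Lemma tm_of_computes (w o : seq sym) q l k n t :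
  n <= t ->
  iter n astep (q0, [::], map inp w) = (q, l, map inp o ++ nseq k bl) ->
  delta q (head bl (map inp o ++ nseq k bl)) = None ->
  computes_within tm_of (map code_sym w) t (map code_sym o).
Proof.
move=> nt e hd; exists n => //.
have -> : init tm_of (map code_sym w) = enc_config (q0, [::], map inp w).
  rewrite /init /= /enc_state eqxx; congr (_, _, _).
  by rewrite -!map_comp; apply: eq_map => a /=; rewrite -enc_sym_inp inord_val.
rewrite iter_step_enc e /= read_map enc_stateK enc_symK hd; split=> //.
elim: o {e hd} => [|a o IH] /=; first by case: k => //= k; rewrite enc_sym_bl.
rewrite enc_sym_inp IH ifT //.
by case: a => [[]|].
Qed.

End AbstractTM.

(** * Machines with several stacks *)

(* [(i, o, b)] asks whether [b] is the truth value of: stack [i] has top [o] ([None] if it is empty). *)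
Definition test := (nat * option sym * bool)%type.

Inductive instr := IPush of nat & sym | IPop of nat | IJumpIfNot of test & nat | IGoto of nat.

Definition stacks := seq (seq sym).
Definition stack (s : stacks) (i : nat) : seq sym := nth [::] s i.
Definition eval_test (t : test) (s : stacks) : bool :=
  (ohead (stack s t.1.1) == t.1.2) == t.2.

Definition jstep (code : seq instr) (c : nat * stacks) : nat * stacks :=
  let: (pc, s) := c in
  match onth code pc with
  | None => c
  | Some (IPush i a) => (pc.+1, set_nth [::] s i (a :: stack s i))
  | Some (IPop i) => (pc.+1, set_nth [::] s i (behead (stack s i)))
  | Some (IJumpIfNot t a) => (if eval_test t s then pc.+1 else a, s)
  | Some (IGoto a) => (a, s)
  end.

(** [PStart] and [PMark] put a marker to the left of the input; [PFetch] decodes an instruction at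
    the first cell. A push shifts a track to the right: [PCarry i o] writes [o] and carries the
    displaced symbol on, then [PBack] returns to the marker. A pop shifts it to the left: [PEnd i]
    walks to the end of the track, and [PPull i o] comes back, writing [o] and taking the old symbol
    along. *)
Inductive phase (K : nat) :=
  | PStart | PMark | PFetch | PBack
  | PEnd of 'I_K | PCarry of 'I_K & option sym | PPull of 'I_K & option sym.
Arguments PStart {K}. Arguments PMark {K}. Arguments PFetch {K}. Arguments PBack {K}.

Definition phase_code K (p : phase K) : 'I_4 + ('I_K + 'I_K * option sym * bool) :=
  match p with
  | PStart => inl (inord 0) | PMark => inl (inord 1) | PFetch => inl (inord 2) | PBack => inl (inord 3)
  | PEnd i => inr (inl i) | PCarry i o => inr (inr (i, o, true)) | PPull i o => inr (inr (i, o, false))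
  end.
Definition phase_decode K (x : 'I_4 + ('I_K + 'I_K * option sym * bool)) : phase K :=
  match x with
  | inl i => match val i with 0 => PStart | 1 => PMark | 2 => PFetch | _ => PBack end
  | inr (inl i) => PEnd i | inr (inr (i, o, true)) => PCarry i o | inr (inr (i, o, false)) => PPull i o
  end.
Lemma phase_codeK K : cancel (@phase_code K) (@phase_decode K).
Proof. by case=> //=; rewrite inordK. Qed.
HB.instance Definition _ K := Finite.copy (phase K) (can_type (@phase_codeK K)).

(** * One tape with a track for each stack *)

Section TrackMachine.
Variables (k : nat) (code : seq instr).
Notation K := k.+1.
Notation n := (size code).

Definition ctl := ('I_n.+1 * phase K)%type.
(* [None] marks the cell to the left of the tracks *)
Definition cell := option {ffun 'I_K -> option sym}.
Definition no_cell : cell := Some [ffun => None].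
Definition input_cell (a : sym) : cell := Some [ffun i => if i == ord0 then Some a else None].

Definition put (i : 'I_K) (o : option sym) (v : {ffun 'I_K -> option sym}) : {ffun 'I_K -> option sym} :=
  [ffun j => if j == i then o else v j].

Definition tm_test (t : test) (v : {ffun 'I_K -> option sym}) : bool :=
  (v (inord t.1.1) == t.1.2) == t.2.

Definition track_delta (q : ctl) (x : cell) : option (ctl * cell * move) :=
  let: (pc, ph) := q in
  match ph, x with
  | PStart, _ => Some ((pc, PMark), x, MoveL)
  | PMark, _ => Some ((pc, PFetch), None, MoveR)
  | PFetch, Some v =>
    match onth code pc with
    | None => None
    | Some (IPush i a) => Some ((inord pc.+1, PCarry (inord i) (Some a)), x, Stay)
    | Some (IPop i) => Some ((inord pc.+1, PEnd (inord i)), x, Stay)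
    | Some (IJumpIfNot t a) => Some ((inord (if tm_test t v then pc.+1 else a), PFetch), x, Stay)
    | Some (IGoto a) => Some ((inord a, PFetch), x, Stay)
    end
  | PCarry i o, Some v =>
    if v i == None then Some ((pc, PBack), Some (put i o v), Stay)
    else Some ((pc, PCarry i (v i)), Some (put i o v), MoveR)
  | PBack, Some v => Some (q, x, MoveL)
  | PBack, None => Some ((pc, PFetch), None, MoveR)
  | PEnd i, Some v =>
    if v i == None then Some ((pc, PPull i None), x, MoveL) else Some (q, x, MoveR)
  | PPull i o, Some v => Some ((pc, PPull i (v i)), Some (put i o v), MoveL)
  | PPull i o, None => Some ((pc, PFetch), None, MoveR)
  | _, _ => None
  end.

Notation tstep := (astep no_cell track_delta).

Definition track (i : 'I_K) (x : cell) : option sym := if x is Some v then v i else None.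
Definition putc (i : 'I_K) (o : option sym) (x : cell) : cell := omap (put i o) x.

Definition cell_at (s : stacks) (p : nat) : cell := Some [ffun i : 'I_K => onth (stack s i) p].

(** Stated cell by cell with a blank as default, because the head turns missing cells into explicit
    blanks: [r] is determined only up to trailing blanks. *)
Definition represents (s : stacks) (r : seq cell) : Prop := forall p, nth no_cell r p = cell_at s p.

Lemma carry_run w i o l r pc :
  (forall p, nth no_cell r p != None /\ track i (nth no_cell r p) = onth w p) ->
  exists cs r', [/\ iter (size w).+1 tstep ((pc, PCarry i o), l, r) = ((pc, PBack), rev cs ++ l, r'),
    size cs = size w &
    forall p, nth no_cell (cs ++ r') p =
      putc i (if p is p'.+1 then onth w p' else o) (nth no_cell r p)].
Proof.
elim: w i o l r => [|a w IH] i o l r hr.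
  have := hr 0; rewrite nth0; case e : (head _ r) => [v|] [] //= _ vi.
  exists [::], (Some (put i o v) :: behead r); split => //.
    by rewrite /= e vi.
  case=> [|p] /=; first by rewrite nth0 e.
  rewrite nth_behead; have := hr p.+1; case: nth => [u|] [] //= _ ui; congr Some.
  by apply/ffunP=> j; rewrite ffunE; case: eqP => // ->; rewrite ui; case: (p).
have := hr 0; rewrite nth0; case e : (head _ r) => [v|] [] //= _ vi.
have [p|cs [r' [e1 e2 e3]]] := IH i (Some a) (Some (put i o v) :: l) (behead r).
  by rewrite nth_behead; apply: hr.
exists (Some (put i o v) :: cs), r'; split.
- rewrite -?iterS iterSr [tstep _]/= e /= vi /= rev_cons cat_rcons -e1.
  by [].
- by rewrite /= e2.
case=> [|p] /=; first by rewrite nth0 e.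
by rewrite e3 nth_behead; case: p.
Qed.

Lemma back_run L pc r : all isSome L -> nth no_cell r 0 != None ->
  exists r', iter (size L).+2 tstep ((pc, PBack), L ++ [:: None], r) = ((pc, PFetch), [:: None], r') /\
   forall p, nth no_cell r' p = nth no_cell (rev L ++ r) p.
Proof.
elim: L r => [|x L IH] r.
  rewrite nth0 => _; case e : (head _ r) => [v|] //= _; rewrite e /=.
  exists (Some v :: behead r); split=> // -[|p] /=; first by rewrite nth0 e.
  by rewrite nth_behead.
case: x => // x /= hL; rewrite nth0; case e : (head _ r) => [v|] //= _.
have [r' [e1 e2]] := IH (Some x :: Some v :: behead r) hL isT.
exists r'; split.
  rewrite -?iterS iterSr [tstep _]/= e /=; exact: e1.
move=> p; rewrite e2 rev_cons cat_rcons !nth_cat; case: ifP => // _.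
by case: (p - _) => [|[|q]] //=; rewrite ?nth_behead ?nth0 ?e.
Qed.

Lemma end_run w i l r pc :
  (forall p, nth no_cell r p != None /\ track i (nth no_cell r p) = onth w p) ->
  exists cs r', [/\ iter (size w) tstep ((pc, PEnd i), l, r) = ((pc, PEnd i), rev cs ++ l, r'),
    size cs = size w &
    forall p, nth no_cell (cs ++ r') p = nth no_cell r p].
Proof.
elim: w l r => [|a w IH] l r hr; first by exists [::], r.
have := hr 0; rewrite nth0; case e : (head _ r) => [v|] [] //= _ vi.
have [p|cs [r' [e1 e2 e3]]] := IH (Some v :: l) (behead r).
  by rewrite nth_behead; apply: hr.
exists (Some v :: cs), r'; split.
- rewrite -?iterS iterSr [tstep _]/= e /= vi /= rev_cons cat_rcons -e1.
  by [].
- by rewrite /= e2.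
case=> [|p] /=; first by rewrite nth0 e.
by rewrite e3 nth_behead.
Qed.

(** What the phase [PPull] makes of the cells that it passes. *)
Fixpoint shift_cells (i : 'I_K) (cs : seq cell) (o : option sym) : seq cell :=
  if cs is x :: cs' then
    putc i (if cs' is y :: _ then track i y else o) x :: shift_cells i cs' o
  else [::].

Lemma shift_cells_rcons i cs x o :
  shift_cells i (rcons cs x) o = rcons (shift_cells i cs (track i x)) (putc i o x).
Proof. by elim: cs => //= y [|z cs] // ->. Qed.

Lemma size_shift_cells i cs o : size (shift_cells i cs o) = size cs.
Proof. by elim: cs => //= x cs ->. Qed.

Lemma nth_shift_cells i cs o p : p < size cs ->
  nth no_cell (shift_cells i cs o) p =
  putc i (if p.+1 < size cs then track i (nth no_cell cs p.+1) else o) (nth no_cell cs p).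
Proof. elim: cs p => //= x cs IH [|p] hp. by case: cs {IH hp}. by rewrite /= IH. Qed.

(** The head moves from the last cell to the first, hence the induction from the end. For empty [cs]
    it already stands on the marker, which explains the default of [head]. *)
Lemma pull_run cs i o r pc : all isSome cs ->
  iter (size cs).+1 tstep ((pc, PPull i o),
     (if rev cs is _ :: L then L ++ [:: None] else [::]), head None (rev cs) :: r) =
  ((pc, PFetch), [:: None], shift_cells i cs o ++ r).
Proof.
elim/last_ind: cs o r => [|cs [x|] IH] o r //; last by rewrite all_rcons.
rewrite all_rcons /= => hc; rewrite rev_rcons shift_cells_rcons cat_rcons.
rewrite -(IH (track i (Some x)) (Some (put i o x) :: r) hc).
rewrite size_rcons -iterS iterSr; congr (iter _ _ _).
by rewrite /=; case: (rev cs).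
Qed.

End TrackMachine.

Definition total (s : stacks) : nat := sumn (map size s).

Lemma size_stack_total s i : size (stack s i) <= total s.
Proof.
elim: s i => [|x s IH] [|i] //=; rewrite /total /=; first exact: leq_addr.
exact: leq_trans (IH i) (leq_addl _ _).
Qed.

Lemma total_set_nth s i w : i < size s -> total (set_nth [::] s i w) + size (stack s i) = total s + size w.
Proof.
elim: s i => [|x s IH] [|i] //= hi; rewrite /total /= -?/(total _); first lia.
by have := IH i hi; rewrite /stack /=; lia.
Qed.

Definition wf_instr (K n : nat) (x : instr) : bool :=
  match x with
  | IPush i _ => i < K | IPop i => i < K
  | IJumpIfNot t a => (t.1.1 < K) && (a <= n) | IGoto a => a <= n
  end.

Section Simulation.
Variables (k : nat) (code : seq instr).
Notation K := k.+1.
Notation n := (size code).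
Notation tstep := (astep (no_cell k) (@track_delta k code)).
Notation no_cell := (no_cell k).
Hypothesis code_wf : all (wf_instr K n) code.

Lemma wf_onth pc x : onth code pc = Some x -> wf_instr K n x /\ pc < n.
Proof.
move=> e; have h : pc < n by rewrite -onthTE e.
split=> //; rewrite -(onth_nth x x _ _ e).
exact: (all_nthP x code_wf).
Qed.

Lemma jstep_size pc s : size s = K -> pc <= n ->
  [/\ size (jstep code (pc, s)).2 = K, (jstep code (pc, s)).1 <= n & total (jstep code (pc, s)).2 <= (total s).+1].
Proof.
move=> hs hpc; rewrite /jstep; case e : (onth code pc) => [[i a|i|t a|a]|] //=.
- have [hi hp] := wf_onth e; rewrite size_set_nth hs; split=> //; first exact/maxn_idPr.
  by have := @total_set_nth s i (a :: stack s i); rewrite hs /= => /(_ hi); lia.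
- have [hi hp] := wf_onth e; rewrite size_set_nth hs; split=> //; first exact/maxn_idPr.
  by have := @total_set_nth s i (behead (stack s i)); rewrite hs /= size_behead => /(_ hi); lia.
- by have [/andP[hi ha] hp] := wf_onth e; split=> //; case: ifP.
- by have [ha hp] := wf_onth e.
Qed.

Lemma nth_head_behead (r : seq (cell k)) p : nth no_cell (head no_cell r :: behead r) p = nth no_cell r p.
Proof. by case: p => [|p] /=; rewrite ?nth0 ?nth_behead. Qed.

Lemma cell_at_track s p (i : 'I_K) : track i (cell_at k s p) = onth (stack s i) p.
Proof. by rewrite /= ffunE. Qed.

Lemma putc_cell_at s i w p : i < K ->
  putc (inord i) (onth w p) (cell_at k s p) = cell_at k (set_nth [::] s i w) p.
Proof.
move=> hi; congr Some; apply/ffunP=> j; rewrite !ffunE /stack nth_set_nth /=.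
by rewrite -val_eqE /= inordK //; case: eqP.
Qed.

Lemma represents_push s i a r cs r' : i < K -> represents s r ->
  (forall p, nth no_cell (cs ++ r') p =
      putc (inord i) (if p is p'.+1 then onth (stack s i) p' else Some a) (nth no_cell r p)) ->
  represents (set_nth [::] s i (a :: stack s i)) (cs ++ r').
Proof. by move=> hi hr h p; rewrite h hr -putc_cell_at //; case: p. Qed.

Lemma all_isSome_cells s r (cs r' : seq (cell k)) : represents s r ->
  (forall p, nth no_cell (cs ++ r') p = nth no_cell r p) -> all isSome cs.
Proof.
move=> hr h; apply/(all_nthP no_cell) => p hp.
by have := h p; rewrite nth_cat hp hr => ->.
Qed.

Lemma ohead_onth T (w : seq T) : onth w 0 = ohead w.
Proof. by case: w. Qed.

(** On a stack of height [h] a push takes [2 * h + 4] steps and a pop [2 * h + 3], since the head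
    walks along the track and back; [total s] bounds every height. *)
Lemma fetch_sim pc s r : size s = K -> pc <= n -> represents s r ->
  exists m r', [/\ m <= 2 * total s + 4,
    iter m tstep ((inord pc, PFetch), [:: None], r) =
      ((inord (jstep code (pc, s)).1, PFetch), [:: None], r') &
    represents (jstep code (pc, s)).2 r'].
Proof.
move=> hs hpc hr.
have hd : head no_cell r = cell_at k s 0 by rewrite -nth0 hr.
have hr1 : represents s (head no_cell r :: behead r).
  by move=> p; rewrite nth_head_behead.
have pcE : (inord pc : 'I_n.+1) = pc :> nat by rewrite inordK.
rewrite /jstep; case e : (onth code pc) => [[i a|i|t a|a]|] /=; last first.
- by exists 0, r.
- exists 1, (head no_cell r :: behead r); split; [lia| |exact: hr1].
  by rewrite /= hd /= pcE e.
- exists 1, (head no_cell r :: behead r); split; [lia| |exact: hr1].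
  have [/andP[hi _] _] := wf_onth e.
  rewrite /= hd /= pcE e /=; congr (inord (if _ then _ else _), _, _, _).
  by rewrite /tm_test ffunE inordK // ohead_onth.
- have [hi _] := wf_onth e; set w := stack s i.
  have hc p : nth no_cell (head no_cell r :: behead r) p != None /\
      track (inord i) (nth no_cell (head no_cell r :: behead r) p) = onth w p.
    by rewrite hr1 cell_at_track inordK.
  have [cs [r1 [e1 e2 e3]]] := end_run [:: None] (inord pc.+1 : 'I_n.+1) hc.
  have hcs := all_isSome_cells hr1 e3.
  have h0 : nth no_cell r1 0 = cell_at k s (size w).
    by have := e3 (size w); rewrite nth_cat e2 ltnn subnn hr1.
  (* From right to left: one step to decode, [size w] to reach the end of the track, one to turn
     round, and the way back including the step off the marker. *)
  exists ((size cs).+1 + (1 + (size w + 1))), (shift_cells (inord i) cs None ++ head no_cell r1 :: behead r1).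
  split.
  + by have := size_stack_total s i; rewrite e2 -/w; lia.
  + rewrite iterD [iter (1 + _) _ _]iterD [iter (_ + 1) _ _]iterD.
    have -> : iter 1 tstep ((inord pc, PFetch), [:: None], r) =
       ((inord pc.+1, PEnd (inord i)), [:: None], head no_cell r :: behead r).
      by rewrite /= hd /= pcE e.
    rewrite e1 -(@pull_run k code cs (inord i) None (head no_cell r1 :: behead r1) (inord pc.+1) hcs).
    congr iter; rewrite /= -nth0 h0 /= ffunE inordK // -/w onth_default //=.
    by case: (rev cs).
  + move=> p; rewrite nth_cat size_shift_cells; case: ltnP => hp.
      rewrite nth_shift_cells //.
      have -> : nth no_cell cs p = cell_at k s p by have := e3 p; rewrite nth_cat hp hr1.
      rewrite -putc_cell_at //; congr putc.
      have -> : onth (behead w) p = onth w p.+1 by case: (w) => //=; case: p {hp}.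
      case: ltnP => hp'; last by rewrite onth_default // -e2.
      by have := e3 p.+1; rewrite nth_cat hp' hr1 => ->; rewrite cell_at_track inordK.
    rewrite nth_head_behead.
    have -> : nth no_cell r1 (p - size cs) = cell_at k s p.
      by have := e3 p; rewrite nth_cat ltnNge hp /= hr1.
    rewrite -putc_cell_at // onth_default ?size_behead; last by rewrite -/w -e2 (leq_trans (leq_pred _)).
    congr Some; apply/ffunP=> j; rewrite !ffunE; case: eqP => // ->.
    by rewrite inordK // onth_default // -/w -e2.
have [hi _] := wf_onth e; set w := stack s i.
have hc p : nth no_cell (head no_cell r :: behead r) p != None /\
    track (inord i) (nth no_cell (head no_cell r :: behead r) p) = onth w p.
  by rewrite hr1 cell_at_track inordK.
have [cs [r1 [e1 e2 e3]]] := carry_run (Some a) [:: None] (inord pc.+1 : 'I_n.+1) hc.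
have hrep := represents_push hi hr1 e3.
have hcs : all isSome (rev cs) by rewrite all_rev; apply: (all_isSome_cells hrep).
have h0 : nth no_cell r1 0 != None.
  by have := hrep (size w); rewrite nth_cat e2 ltnn subnn => ->.
have [r2 [e4 e5]] := @back_run k code _ (inord pc.+1) r1 hcs h0.
exists ((size (rev cs)).+2 + ((size w).+1 + 1)), r2; split.
- by have := size_stack_total s i; rewrite size_rev e2 -/w; lia.
- rewrite iterD [iter (_ + 1) _ _]iterD.
  have -> : iter 1 tstep ((inord pc, PFetch), [:: None], r) =
     ((inord pc.+1, PCarry (inord i) (Some a)), [:: None], head no_cell r :: behead r).
    by rewrite /= hd /= pcE e.
  by rewrite e1 e4.
by move=> p; rewrite e5 revK.
Qed.

(** An instruction adds at most one symbol, so no stack exceeds [total s + t] during the run. *)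
Lemma run_sim t pc s r : size s = K -> pc <= n -> represents s r ->
  exists m r', [/\ m <= t * (2 * (total s + t) + 4),
    iter m tstep ((inord pc, PFetch), [:: None], r) =
      ((inord (iter t (jstep code) (pc, s)).1, PFetch), [:: None], r') &
    represents (iter t (jstep code) (pc, s)).2 r'].
Proof.
elim: t pc s r => [|t IH] pc s r hs hpc hr; first by exists 0, r.
have [m [r1 [h1 h2 h3]]] := fetch_sim hs hpc hr.
have [hs' hpc' ht] := jstep_size hs hpc.
have [m' [r2 [h4 h5 h6]]] := IH _ _ _ hs' hpc' h3.
exists (m' + m), r2; rewrite iterSr -surjective_pairing in h5 h6 *; split=> //.
  nia.
by rewrite iterD h2 h5.
Qed.

Lemma input_cell_inj : injective (@input_cell k).
Proof. by move=> a b [] /ffunP/(_ ord0); rewrite !ffunE eqxx => -[]. Qed.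

Lemma input_cell_blank a : input_cell k a != no_cell.
Proof. by apply/eqP => -[] /ffunP/(_ ord0); rewrite !ffunE eqxx. Qed.

Definition track_machine : TM :=
  tm_of ((ord0 : 'I_n.+1), @PStart K) no_cell (@input_cell k) (@track_delta k code).

Lemma track_machine_computes w o t :
  iter t (jstep code) (0, w :: nseq k [::]) = (n, o :: nseq k [::]) ->
  computes_within track_machine (map code_sym w)
    (2 + t * (2 * (size w + t) + 4)) (map code_sym o).
Proof.
move=> e; pose s0 : stacks := w :: nseq k [::].
have stackE (v : seq sym) (i : 'I_K) : stack (v :: nseq k [::]) i = if i == ord0 then v else [::].
  by case: i => -[|i] hi; rewrite /stack //= nth_nseq if_same.
have cellE (v : seq sym) p : cell_at k (v :: nseq k [::]) p = nth no_cell (map (@input_cell k) v) p.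
  case: (ltnP p (size v)) => hp.
    rewrite (nth_map None) //; congr Some; apply/ffunP => i; rewrite !ffunE stackE.
    by case: ifP; rewrite ?onth0n // onthE (nth_map None).
  rewrite nth_default ?size_map //; congr Some; apply/ffunP => i; rewrite !ffunE stackE.
  by case: ifP; rewrite ?onth0n // onth_default.
have hs : size s0 = K by rewrite /= size_nseq.
pose r0 := map (@input_cell k) w.
have hr : represents s0 (head no_cell r0 :: behead r0).
  by move=> p; rewrite nth_head_behead cellE.
have [m [r [h1 h2 h3]]] := run_sim t hs (leq0n n) hr.
rewrite e /= in h2 h3.
(* The final tape is known up to trailing blanks; it is at least as long as [o] because an output
   cell is never blank. *)
have er : r = map (@input_cell k) o ++ nseq (size r - size o) no_cell.
  have so : size o <= size r.
    rewrite leqNgt; apply/negP=> hlt; have := h3 (size r).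
    rewrite nth_default // cellE (nth_map None) // => /esym/eqP.
    by rewrite (negbTE (input_cell_blank _)).
  apply: (@eq_from_nth _ no_cell); first by rewrite size_cat size_map size_nseq subnKC.
  move=> p hp; rewrite h3 cellE nth_cat size_map; case: ltnP => // hop.
  by rewrite nth_nseq if_same nth_default // size_map.
apply: (@tm_of_computes _ _ _ _ _ _ input_cell_inj input_cell_blank w o
   (inord n, PFetch) [:: None] (size r - size o) (m + 2)).
- have -> : size w = total s0 by rewrite /total /= map_nseq sumn_nseq addn0.
  lia.
- rewrite iterD.
  have -> : iter 2 tstep (ord0, PStart, [::], r0) = (inord 0, PFetch, [:: None], head no_cell r0 :: behead r0).
    by rewrite /=; congr (_, _, _, _); apply/val_inj; rewrite /= inordK.
  by rewrite h2 -er.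
rewrite -er -nth0 h3 /= inordK // onth_default //.
Qed.

End Simulation.

(** * Structured programs *)

Inductive cmd :=
  | Skip | Push of nat & sym | Pop of nat | Seq of cmd & cmd
  | If of test & cmd & cmd | While of test & cmd.

(** Times are the exact instruction counts of the compiled code: a true branch pays for the test and
    the jump over the other branch, a false one for the test only, and a round of a loop for the
    test and the jump back. *)
Inductive exec : cmd -> stacks -> stacks -> nat -> Prop :=
  | ESkip s : exec Skip s s 0
  | EPush i a s : exec (Push i a) s (set_nth [::] s i (a :: stack s i)) 1
  | EPop i s : exec (Pop i) s (set_nth [::] s i (behead (stack s i))) 1
  | ESeq c d s1 s2 s3 t u : exec c s1 s2 t -> exec d s2 s3 u -> exec (Seq c d) s1 s3 (t + u)
  | EIfTrue x c d s s' t : eval_test x s -> exec c s s' t -> exec (If x c d) s s' t.+2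
  | EIfFalse x c d s s' t : ~~ eval_test x s -> exec d s s' t -> exec (If x c d) s s' t.+1
  | EWhileEnd x c s : ~~ eval_test x s -> exec (While x c) s s 1
  | EWhileStep x c s1 s2 s3 t u : eval_test x s1 -> exec c s1 s2 t ->
      exec (While x c) s2 s3 u -> exec (While x c) s1 s3 (t + u).+2.

Fixpoint clen (c : cmd) : nat :=
  match c with
  | Skip => 0 | Push _ _ => 1 | Pop _ => 1 | Seq c d => clen c + clen d
  | If _ c d => (clen c + clen d).+2 | While _ c => (clen c).+2
  end.

Fixpoint compile (c : cmd) (a : nat) : seq instr :=
  match c with
  | Skip => [::]
  | Push i x => [:: IPush i x]
  | Pop i => [:: IPop i]
  | Seq c d => compile c a ++ compile d (a + clen c)
  | If x c d => IJumpIfNot x (a + clen c).+2 :: compile c a.+1 ++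
      IGoto (a + clen c + clen d).+2 :: compile d (a + clen c).+2
  | While x c => IJumpIfNot x (a + clen c).+2 :: compile c a.+1 ++ [:: IGoto a]
  end.

Lemma size_compile c a : size (compile c a) = clen c.
Proof.
elim: c a => //= [c IHc d IHd|x c IHc d IHd|x c IHc] a; rewrite size_cat /= ?IHc ?IHd; lia.
Qed.

Definition code_at (code : seq instr) (a : nat) (b : seq instr) : Prop :=
  exists pre post, code = pre ++ b ++ post /\ size pre = a.

Lemma code_at_catl code a b1 b2 : code_at code a (b1 ++ b2) -> code_at code a b1.
Proof. by case=> p [q [-> <-]]; exists p, (b2 ++ q); rewrite !catA. Qed.

Lemma code_at_catr code a b1 b2 : code_at code a (b1 ++ b2) -> code_at code (a + size b1) b2.
Proof. by case=> p [q [-> <-]]; exists (p ++ b1), q; rewrite !catA size_cat. Qed.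

Lemma code_at_cons code a x b : code_at code a (x :: b) -> onth code a = Some x /\ code_at code a.+1 b.
Proof.
move=> h; split; last by have := @code_at_catr code a [:: x] b h; rewrite addn1.
by case: h => p [q [-> <-]]; rewrite onth_cat ltnn subnn.
Qed.

Lemma exec_compile code c s s' t : exec c s s' t -> forall a, code_at code a (compile c a) ->
  iter t (jstep code) (a, s) = (a + clen c, s').
Proof.
elim=> {c s s' t} /=.
- by move=> s a _; rewrite addn0.
- by move=> i x s a /code_at_cons[-> _]; rewrite addn1.
- by move=> i s a /code_at_cons[-> _]; rewrite addn1.
- move=> c d s1 s2 s3 t u _ IH1 _ IH2 a h.
  rewrite addnC iterD (IH1 a (code_at_catl h)) IH2 ?addnA //.
  by have := code_at_catr h; rewrite size_compile.
- move=> x c d s s' t hx _ IH a /code_at_cons[e h].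
  rewrite -!iterS iterSr /= e hx.
  rewrite -iterS iterS (IH _ (code_at_catl h)) /=.
  have := code_at_catr h; rewrite size_compile => /code_at_cons[+ _].
  by rewrite !addSn /= => ->; rewrite !addnS addnA.
- move=> x c d s s' t hx _ IH a /code_at_cons[e h].
  rewrite -iterS iterSr /= e (negbTE hx).
  have := code_at_catr h; rewrite size_compile => /code_at_cons[_].
  by rewrite addSn => /IH ->; rewrite !addSn !addnS addnA.
- move=> x c s hx a /code_at_cons[-> _]; rewrite (negbTE hx); congr (_, _); lia.
move=> x c s1 s2 s3 t u hx _ IH1 _ IH2 a h.
have [e h'] := code_at_cons h.
(* After the first round the counter is again at [a], and the induction hypothesis for the same loop
   at the same address does the rest. *)
rewrite -!iterS (_ : (t + u).+2 = u + t.+2); last by lia.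
rewrite iterD -(IH2 _ h); congr (iter u _ _).
rewrite iterSr [jstep _ _]/= e hx iterS (IH1 _ (code_at_catl h')).
have := code_at_catr h'; rewrite size_compile => /code_at_cons[+ _].
by rewrite !addSn /= => ->.
Qed.

Fixpoint wf_cmd (K : nat) (c : cmd) : bool :=
  match c with
  | Skip => true | Push i _ => i < K | Pop i => i < K
  | Seq c d => wf_cmd K c && wf_cmd K d
  | If x c d => [&& x.1.1 < K, wf_cmd K c & wf_cmd K d]
  | While x c => (x.1.1 < K) && wf_cmd K c
  end.

Lemma wf_compile K c n a : wf_cmd K c -> a + clen c <= n -> all (wf_instr K n) (compile c a).
Proof.
elim: c a => //= [i x|i|c IHc d IHd|x c IHc d IHd|x c IHc] a.
- by rewrite andbT.
- by rewrite andbT.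
- by case/andP=> hc hd h; rewrite all_cat IHc ?IHd //; lia.
- case/and3P=> hx hc hd h; rewrite all_cat /= hx IHc ?IHd //; lia.
case/andP=> hx hc h; rewrite all_cat /= hx IHc //; lia.
Qed.

Lemma exec_computes k c w o t : wf_cmd k.+1 c ->
  exec c (w :: nseq k [::]) (o :: nseq k [::]) t ->
  computes_within (track_machine k (compile c 0)) (map code_sym w)
    (2 + t * (2 * (size w + t) + 4)) (map code_sym o).
Proof.
move=> hw he; apply: track_machine_computes.
  by apply: wf_compile => //; rewrite size_compile.
rewrite (exec_compile he) ?size_compile //.
by exists [::], [::]; rewrite cats0.
Qed.

(** * Binary words *)

Fixpoint bits_pos (p : positive) : seq bool :=
  match p with xH => [:: true] | xO p' => false :: bits_pos p' | xI p' => true :: bits_pos p' end.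

Definition bits (n : nat) : seq bool :=
  match N.of_nat n with N0 => [::] | Npos p => bits_pos p end.

Definition word (n : nat) : seq sym := map Some (bits n).

Lemma code_word n : map code_sym (word n) = bin n.
Proof.
rewrite /word /bits /bin; case: N.of_nat => //.
by elim=> //= p ->.
Qed.

Lemma bits_to_nat p : bits (Pos.to_nat p) = bits_pos p.
Proof. by rewrite /bits -[Pos.to_nat p]/(N.to_nat (Npos p)) N2Nat.id. Qed.

Lemma nat_pos n : 0 < n -> exists p, n = Pos.to_nat p.
Proof. by move=> h; exists (Pos.of_nat n); rewrite Nat2Pos.id //; lia. Qed.

Lemma bits_double n : 0 < n -> bits (2 * n) = false :: bits n.
Proof.
by case/nat_pos=> p ->; rewrite -[2 * _]/(2 * Pos.to_nat p)%coq_nat -Pos2Nat.inj_xO !bits_to_nat.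
Qed.

Lemma bits_doubleS n : bits (2 * n).+1 = true :: bits n.
Proof.
case: (posnP n) => [->//|]; case/nat_pos=> p ->.
by rewrite -[(2 * _).+1]/(S (2 * Pos.to_nat p)%coq_nat) -Pos2Nat.inj_xI !bits_to_nat.
Qed.

Fixpoint incb (w : seq bool) : seq bool :=
  match w with
  | [::] => [:: true] | false :: w' => true :: w' | true :: w' => false :: incb w'
  end.

Lemma bits_succ n : bits n.+1 = incb (bits n).
Proof.
rewrite /bits; have -> : N.of_nat n.+1 = N.succ (N.of_nat n) by rewrite Nat2N.inj_succ.
by case: (N.of_nat n) => //= p; elim: p => //= p ->.
Qed.

Lemma size_bits n : size (bits n) <= n.
Proof.
elim: n => // n IH; rewrite bits_succ.
have h w : size (incb w) <= (size w).+1 by elim: w => // -[].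
exact: leq_trans (h _) _.
Qed.

Lemma size_word n : size (word n) <= n.
Proof. by rewrite size_map size_bits. Qed.

Definition bits3 (k : nat) : seq bool := [:: odd k; odd k./2; odd k./2./2].

(** With the least significant bit first, passing to [8 * u + k] prepends three bits. For [u = 0]
    this would leave zeros at the high end, which the binary representation does not have. *)
Lemma bits_block u k : 0 < u -> k < 8 -> bits (8 * u + k) = bits3 k ++ bits u.
Proof.
move=> u0 hk.
have e j (b : bool) : 0 < j -> bits (2 * j + b) = b :: bits j.
  by move=> j0; case: b; rewrite ?addn1 ?addn0 ?bits_doubleS ?bits_double.
have -> : 8 * u + k = 2 * (2 * (2 * u + odd k./2./2) + odd k./2) + odd k.
  by do 8?[case: k hk => [|k] hk; first by rewrite /=; lia].
by rewrite !e //; lia.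
Qed.

Lemma bits_inj : injective bits.
Proof.
have nz p : bits_pos p <> [::] by case: p.
have pinj : injective bits_pos.
  by elim=> [p IH|p IH|] [q|q|] //= [] // => [/IH ->|/nz|/IH ->|/esym/nz].
move=> m n; rewrite /bits => e; apply: (can_inj Nat2N.id).
by case: (N.of_nat m) (N.of_nat n) e => [|p] [|q] // => [/esym/nz|/nz|/pinj ->].
Qed.

Lemma word_inj : injective word.
Proof. by move=> m n /inj_map e; apply/bits_inj/e => ? ? []. Qed.

(** * Stack programs and their running times *)

Definition upd (s : stacks) (i : nat) (w : seq sym) : stacks := set_nth [::] s i w.

Lemma stack_upd s i w j : stack (upd s i w) j = if j == i then w else stack s j.
Proof. by rewrite /stack /upd nth_set_nth. Qed.

Lemma size_upd s i w : i < size s -> size (upd s i w) = size s.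
Proof. by move=> h; rewrite size_set_nth; apply/maxn_idPr. Qed.

Lemma stacks_ext (s1 s2 : stacks) : size s1 = size s2 -> (forall i, stack s1 i = stack s2 i) -> s1 = s2.
Proof. by move=> e h; apply: (@eq_from_nth _ [::]) => // i _; apply: h. Qed.

Definition runs (c : cmd) (s s' : stacks) (b : nat) : Prop := exists2 t, t <= b & exec c s s' t.

Lemma runs_le c s s' b b' : b <= b' -> runs c s s' b -> runs c s s' b'.
Proof. by move=> h [t ht he]; exists t => //; apply: leq_trans h. Qed.

Lemma runs_skip s : runs Skip s s 0.
Proof. by exists 0 => //; apply: ESkip. Qed.

Lemma runs_push i a s : runs (Push i a) s (upd s i (a :: stack s i)) 1.
Proof. by exists 1 => //; apply: EPush. Qed.

Lemma runs_pop i s : runs (Pop i) s (upd s i (behead (stack s i))) 1.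
Proof. by exists 1 => //; apply: EPop. Qed.

Lemma runs_seq c d s1 s2 s3 b1 b2 : runs c s1 s2 b1 -> runs d s2 s3 b2 -> runs (Seq c d) s1 s3 (b1 + b2).
Proof. by case=> t ht he [u hu he']; exists (t + u); [exact: leq_add | exact: ESeq he he']. Qed.

Lemma runs_if x c d s s' b : runs (if eval_test x s then c else d) s s' b -> runs (If x c d) s s' (b + 2).
Proof.
case: ifP => hx [t ht he].
  by exists t.+2; [rewrite addn2 !ltnS | exact: EIfTrue].
by exists t.+1; [rewrite addn2 !ltnS ltnW | apply: EIfFalse; rewrite ?hx].
Qed.

Lemma runs_while_end x c s : ~~ eval_test x s -> runs (While x c) s s 1.
Proof. by exists 1 => //; apply: EWhileEnd. Qed.

Lemma runs_while_step x c s1 s2 s3 b1 b2 : eval_test x s1 ->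
  runs c s1 s2 b1 -> runs (While x c) s2 s3 b2 -> runs (While x c) s1 s3 (b1 + b2 + 2).
Proof.
move=> hx [t ht he] [u hu he']; exists (t + u).+2; last exact: EWhileStep he'.
by rewrite addn2 !ltnS leq_add.
Qed.

Definition on_top (i : nat) (c : sym -> cmd) : cmd :=
  If (i, Some (Some false), true) (c (Some false))
    (If (i, Some (Some true), true) (c (Some true)) (c None)).

Lemma runs_on_top i c a w s s' b : stack s i = a :: w -> runs (c a) s s' b -> runs (on_top i c) s s' (b + 4).
Proof.
move=> e h; rewrite (_ : b + 4 = b + 2 + 2); last by lia.
apply: runs_if; rewrite /eval_test e /=.
case: a e h => [[]|] e h /=; last first.
- by apply: runs_if; rewrite /eval_test e.
- by apply: runs_le h; apply: leq_addr.
- by apply: runs_if; rewrite /eval_test e.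
Qed.

Definition push_all (js : seq nat) (a : sym) : cmd := foldr (fun j => Seq (Push j a)) Skip js.

Definition deposit (js : seq nat) (w : seq sym) (s : stacks) : stacks :=
  foldl (fun s j => upd s j (rev w ++ stack s j)) s js.

Definition in_range (js : seq nat) (s : stacks) : bool := all (fun j => j < size s) js.

Lemma in_range_size js s s' : size s' = size s -> in_range js s -> in_range js s'.
Proof. by rewrite /in_range => ->. Qed.

Lemma size_deposit js w s : in_range js s -> size (deposit js w s) = size s.
Proof.
elim: js s => //= j js IH s /andP[hj hjs]; rewrite IH ?size_upd //.
by apply: in_range_size hjs; rewrite size_upd.
Qed.

Lemma stack_deposit js w s i : uniq js ->
  stack (deposit js w s) i = if i \in js then rev w ++ stack s i else stack s i.
Proof.
elim: js s => //= j js IH s /andP[hj /IH ->]; rewrite !stack_upd inE.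
by case: (i =P j) => [->|]; rewrite ?(negbTE hj).
Qed.

Lemma runs_push_all js a s : runs (push_all js a) s (deposit js [:: a] s) (size js).
Proof.
elim: js s => [|j js IH] s /=; first exact: runs_skip.
by rewrite -add1n; apply: runs_seq (IH _); apply: runs_push.
Qed.

(** One loop for all transfers: depending on the test it stops at the bottom, at a separator or
    after a run of ones; two targets make copies, and no target clears the stack. The order is
    reversed. *)
Definition drain (o : option sym) (p : bool) (i : nat) (js : seq nat) : cmd :=
  While (i, o, p) (on_top i (fun a => Seq (Pop i) (push_all js a))).

Lemma runs_drain o p i js s w r :
  i < size s -> in_range js s -> uniq (i :: js) -> stack s i = w ++ r ->
  all (fun a => (Some a == o) == p) w -> (ohead r == o) != p ->
  runs (drain o p i js) s (upd (deposit js w s) i r) ((size js + 7) * size w + 1).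
Proof.
move=> hi hjs hu; have /andP[hij ujs] := hu.
elim: w s hi hjs => [|a w IH] s hi hjs e /=.
  move=> _ hr; rewrite muln0.
  have -> : upd (deposit js [::] s) i r = s.
    apply: stacks_ext => [|j]; first by rewrite size_upd size_deposit.
    by rewrite stack_upd stack_deposit // if_same; case: eqP => [->|].
  by apply: runs_while_end; rewrite /eval_test e.
move=> /andP[ha hw] hr.
pose s1 := deposit js [:: a] (upd s i (w ++ r)).
have hjs' : in_range js (upd s i (w ++ r)) by apply: in_range_size hjs; rewrite size_upd.
have hs1 : size s1 = size s by rewrite size_deposit // size_upd.
have hjs1 : in_range js s1 by apply: in_range_size hjs.
have := IH s1; rewrite hs1 {1}/s1 stack_deposit // (negbTE hij) stack_upd eqxx.
move=> /(_ hi hjs1 erefl hw hr) IH1.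
have -> : upd (deposit js (a :: w) s) i r = upd (deposit js w s1) i r.
  apply: stacks_ext => [|j]; first by rewrite size_upd size_deposit // size_upd size_deposit ?hs1.
  rewrite !stack_upd; case: eqP => // /eqP hj; rewrite !stack_deposit // stack_upd (negbTE hj).
  by rewrite rev_cons cat_rcons; case: ifP.
apply: runs_le (runs_while_step _ _ IH1); last first.
- apply: (@runs_on_top _ _ a (w ++ r)); first by rewrite e.
  apply: runs_seq (runs_push_all _ _ _).
  by have := runs_pop i s; rewrite e; apply.
- by rewrite /eval_test e.
by rewrite mulnS; lia.
Qed.

(** The carry runs through the initial ones. Then [r] starts with a zero, which becomes a one, or is
    empty and gets a new bit; [behead] covers both cases. *)
Lemma incb_split w : exists m r, [/\ w = nseq m true ++ r, ohead r != Some true &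
  incb w = nseq m false ++ true :: behead r].
Proof.
elim: w => [|[] w [m [r [e h e']]]]; first by exists 0, [::].
  by exists m.+1, r; rewrite /= -e e'.
by exists 0, (false :: w).
Qed.

Lemma upd_id s i : i < size s -> upd s i (stack s i) = s.
Proof.
move=> h; apply: stacks_ext => [|j]; first by rewrite size_upd.
by rewrite stack_upd; case: eqP => [->|].
Qed.

Lemma upd_upd s i x y : i < size s -> upd (upd s i x) i y = upd s i y.
Proof.
move=> h; apply: stacks_ext => [|j]; first by rewrite !size_upd.
by rewrite !stack_upd; case: eqP.
Qed.

Lemma nseq_shift T m (x : T) w : nseq m.+1 x ++ w = nseq m x ++ x :: w.
Proof. by elim: m => //= m ->. Qed.

(* Stack 0: input and output; 1 and 2: names left to the outer and inner loop; 3: names passed by the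
   inner loop; 4 and 6: current outer and inner name, reversed; 5: scratch; 7: mismatch marks;
   8 and 9: numbers of the current occurrences; 10: scratch. *)
Definition refill (j : nat) : cmd :=
  While (10, None, false) (Seq (Pop 10) (Push j (Some false))).

Lemma runs_refill j m s w : j < size s -> 10 < size s -> j != 10 ->
  stack s 10 = nseq m (Some true) -> stack s j = w ->
  runs (refill j) s (upd (upd s 10 [::]) j (nseq m (Some false) ++ w)) (4 * m + 1).
Proof.
move=> hj h10 hne; elim: m s w hj h10 => [|m IH] s w hj h10 e ej.
  have -> : upd (upd s 10 [::]) j w = s.
    apply: stacks_ext => [|i]; first by rewrite !size_upd.
    by rewrite !stack_upd; case: eqP => [->|_]; [|case: eqP => [->|]].
  by apply: runs_while_end; rewrite /eval_test e.
set s1 := upd (upd s 10 (nseq m (Some true))) j (Some false :: w).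
have hs : size s1 = size s by rewrite !size_upd.
have IH1 : runs (refill j) s1 (upd (upd s1 10 [::]) j (nseq m (Some false) ++ Some false :: w)) (4 * m + 1).
  by apply: IH; rewrite ?hs // !stack_upd ?eqxx // eq_sym (negbTE hne).
have -> : upd (upd s 10 [::]) j (nseq m.+1 (Some false) ++ w) =
   upd (upd s1 10 [::]) j (nseq m (Some false) ++ Some false :: w).
  apply: stacks_ext => [|i]; first by rewrite !size_upd ?hs.
  rewrite !stack_upd; case: eqP => // _.
    by rewrite -nseq_shift.
  by case: eqP.
apply: runs_le (runs_while_step _ _ IH1); last first.
- apply: runs_seq; first exact: runs_pop.
  by rewrite e /s1; have := runs_push j (Some false) (upd s 10 (nseq m (Some true)));
     rewrite stack_upd (negbTE hne) ej; apply.
- by rewrite /eval_test e.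
by lia.
Qed.

(** The initial ones are parked on stack 10, where their number tells [refill] how many zeros to put
    back. The zero that stops the carry may be missing, hence the test before [Pop]. *)
Definition inc (j : nat) : cmd :=
  Seq (drain (Some (Some true)) true j [:: 10])
  (Seq (If (j, Some (Some false), true) (Pop j) Skip)
  (Seq (Push j (Some true)) (refill j))).

Lemma runs_inc j n s : j < size s -> 10 < size s -> j != 10 ->
  stack s 10 = [::] -> stack s j = word n ->
  runs (inc j) s (upd s j (word n.+1)) (12 * n + 6).
Proof.
move=> hj h10 hne e10 ej; rewrite /word bits_succ.
have [m [r [ew hr ->]]] := incb_split (bits n).
pose r' : seq sym := map Some r.
have er : stack s j = nseq m (Some true) ++ r' by rewrite ej /word ew map_cat map_nseq.
have hm : m <= n.
  by apply: leq_trans (size_bits n); rewrite ew size_cat size_nseq leq_addr.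
pose s1 := upd (deposit [:: 10] (nseq m (Some true)) s) j r'.
have hs1 : size s1 = size s by rewrite size_upd size_deposit //= h10.
have R1 : runs (drain (Some (Some true)) true j [:: 10]) s s1 (8 * m + 1).
  have := @runs_drain (Some (Some true)) true j [:: 10] s (nseq m (Some true)) r' hj.
  rewrite size_nseq /= h10 inE hne; apply=> //; first by rewrite all_nseq /= orbT.
  by rewrite /r'; case: (r) hr => [|[]].
pose s2 := upd s1 j (behead r').
have s1j : stack s1 j = r' by rewrite stack_upd eqxx.
have s110 : stack s1 10 = nseq m (Some true).
  by rewrite stack_upd eq_sym (negbTE hne) stack_deposit // mem_head e10 cats0 rev_nseq.
have R2 : runs (If (j, Some (Some false), true) (Pop j) Skip) s1 s2 (1 + 2).
  apply: runs_if; rewrite /eval_test s1j /=; case: eqP => [e|]; rewrite /=.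
    by rewrite /s2 -s1j; apply: runs_pop.
  move=> ne; apply: (runs_le (b := 0)) => //.
  have -> : s2 = s1; last exact: runs_skip.
  have e : r' = [::] by move: ne; rewrite /r'; case: (r) hr => [|[]].
  by rewrite /s2 e -[X in upd _ _ X]e -s1j upd_id // hs1.
pose s3 := upd s2 j (Some true :: behead r').
have hs2 : size s2 = size s by rewrite size_upd hs1.
have R3 : runs (Push j (Some true)) s2 s3 1.
  by have := runs_push j (Some true) s2; rewrite {2}/s2 stack_upd eqxx.
have R4 := @runs_refill j m s3 (Some true :: behead r').
have -> : upd s j [seq Some i | i <- nseq m false ++ true :: behead r] =
    upd (upd s3 10 [::]) j (nseq m (Some false) ++ Some true :: behead r').
  apply: stacks_ext => [|i]; first by rewrite !size_upd ?hs1.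
  rewrite !stack_upd; case: eqP => [_|/eqP hi].
    by rewrite map_cat map_nseq /= -behead_map.
  case: eqP => [->|/eqP hi']; first by rewrite e10.
  by [].
apply: runs_le (runs_seq R1 (runs_seq R2 (runs_seq R3 (R4 _ _ _ _ _)))) => //.
- by lia.
- by rewrite size_upd hs2.
- by rewrite size_upd hs2.
- by rewrite !stack_upd eq_sym (negbTE hne) eqxx e10 cats0 rev_nseq.
by rewrite ?stack_upd eqxx.
Qed.

(** Two transfers reverse twice, so the number reaches the output in the right order, and the second
    one also restores stack [j]. *)
Definition emit_num (j : nat) : cmd :=
  Seq (drain None false j [:: 10]) (drain None false 10 [:: j; 0]).

Lemma runs_emit_num j s w : j < size s -> 10 < size s -> j != 10 -> j != 0 ->
  stack s 10 = [::] -> stack s j = w ->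
  runs (emit_num j) s (upd s 0 (w ++ stack s 0)) (17 * size w + 2).
Proof.
move=> hj h10 hne hn0 e10 ej.
pose s1 := upd (deposit [:: 10] w s) j [::].
have hs1 : size s1 = size s by rewrite size_upd size_deposit //= h10.
have R1 : runs (drain None false j [:: 10]) s s1 (8 * size w + 1).
  have := @runs_drain None false j [:: 10] s w [::] hj.
  rewrite /= h10 inE hne cats0; apply=> //; exact/allP.
have e1 : stack s1 10 = rev w.
  by rewrite stack_upd eq_sym (negbTE hne) stack_deposit // mem_head e10 cats0.
have R2 := @runs_drain None false 10 [:: j; 0] s1 (rev w) [::].
have -> : upd s 0 (w ++ stack s 0) = upd (deposit [:: j; 0] (rev w) s1) 10 [::].
  have r : in_range [:: j; 0] s1 by rewrite /= hs1 hj (leq_ltn_trans _ h10).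
  apply: stacks_ext => [|i]; first by rewrite !size_upd ?size_deposit // ?hs1 // (leq_ltn_trans _ h10).
  rewrite !stack_upd; case: (i =P 10) => [->|/eqP hi]; first by rewrite e10.
  rewrite [0 == j]eq_sym (negbTE hn0) eqxx revK.
  case: (i =P j) => [->|_]; last by case: (i == 0).
  by rewrite (negbTE hn0) ej cats0.
apply: runs_le (runs_seq R1 (R2 _ _ _ _ _ _)); rewrite ?hs1 //=.
- by rewrite size_rev; lia.
- by rewrite hs1 hj (leq_ltn_trans _ h10).
- by rewrite !inE eq_sym (negbTE hne) /= andbT hn0.
- exact: etrans e1 (esym (cats0 _)).
by apply/allP.
Qed.

Definition push_word (w : seq sym) : cmd := foldr (fun a c => Seq c (Push 0 a)) Skip w.

Lemma runs_push_word w s : 0 < size s -> runs (push_word w) s (upd s 0 (w ++ stack s 0)) (size w).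
Proof.
move=> h; elim: w => [|a w IH].
  by rewrite [_ ++ _]/(stack s 0) upd_id //; apply: runs_skip.
rewrite [size _]/= -addn1; apply: runs_seq IH _.
by have := runs_push 0 a (upd s 0 (w ++ stack s 0)); rewrite stack_upd eqxx upd_upd.
Qed.

Definition ready (s : stacks) (u v : nat) : Prop :=
  [/\ size s = 11, stack s 8 = word u, stack s 9 = word v & stack s 10 = [::]].

Lemma ready_upd s u v w : ready s u v -> ready (upd s 0 w) u v.
Proof. by case=> h e1 e2 e3; split; rewrite ?stack_upd // size_upd h. Qed.

(** By [word_block] a slot is written as its three bits in front of the number of its block, so the
    bits are pushed last. Block 0 is excluded there, so its numbers are written out literally. *)
Definition emit_vert (x : vert) : cmd :=
  if x.1 == 0 then push_word (word x.2) else
  Seq (emit_num (if x.1 == 1 then 8 else 9)) (push_word (map Some (bits3 x.2))).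

Lemma word_block u k : 0 < u -> k < 8 -> word (8 * u + k) = map Some (bits3 k) ++ word u.
Proof. by move=> hu hk; rewrite /word bits_block // map_cat. Qed.

Lemma runs_emit_block j z k s B : j < size s -> 10 < size s -> j != 10 -> j != 0 ->
  stack s 10 = [::] -> stack s j = word z -> 0 < z <= B -> k < 8 ->
  runs (Seq (emit_num j) (push_word (map Some (bits3 k)))) s
    (upd s 0 (word (8 * z + k) ++ stack s 0)) (17 * B + 8).
Proof.
move=> hj h10 j10 j0 e10 ej /andP[z0 zB] hk; rewrite word_block // -catA.
have s0 : 0 < size s by apply: leq_ltn_trans h10.
have R1 := runs_emit_num hj h10 j10 j0 e10 ej.
have := runs_push_word (map Some (bits3 k)) (s := upd s 0 (word z ++ stack s 0)).
rewrite stack_upd eqxx upd_upd // size_upd // => /(_ s0).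
rewrite [X in runs _ _ _ X](erefl : _ = 3) => R2.
by apply: runs_le (runs_seq R1 R2); have := size_word z; lia.
Qed.

Lemma runs_emit_vert x s u v B : ready s u v -> x \in verts -> 0 < u <= B -> 0 < v <= B ->
  runs (emit_vert x) s (upd s 0 (word (place u v x) ++ stack s 0)) (17 * B + 8).
Proof.
move=> hr; have [hs e8 e9 e10] := hr; case: x => i k; rewrite mem_verts => /andP[hi hk].
move=> /andP[u0 uB] /andP[v0 vB]; rewrite /emit_vert /place /=.
case: i hi => [|i] hi /=.
  rewrite muln0 add0n; apply: runs_le (runs_push_word _ _); rewrite ?hs //.
  by have := size_word k; lia.
have main j z : j < size s -> j != 10 -> j != 0 -> stack s j = word z -> 0 < z <= B ->
   runs (Seq (emit_num j) (push_word (map Some (bits3 k)))) s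
     (upd s 0 (word (8 * z + k) ++ stack s 0)) (17 * B + 8).
  by move=> hj j10 j0 ej hz; apply: runs_emit_block; rewrite // hs.
case: i hi => [|[|i]] //= _; first by apply: main; rewrite ?hs ?u0.
by apply: main; rewrite ?hs ?v0.
Qed.

Definition triple_word (t : nat * nat * nat) : seq sym :=
  word t.1.1 ++ None :: word t.1.2 ++ None :: word t.2 ++ [:: None].

Definition emit_sep_vert (x : vert) : cmd := Seq (Push 0 None) (emit_vert x).

Lemma runs_emit_sep_vert x s u v B : ready s u v -> x \in verts -> 0 < u <= B -> 0 < v <= B ->
  runs (emit_sep_vert x) s (upd s 0 (word (place u v x) ++ None :: stack s 0)) (17 * B + 9).
Proof.
move=> hr hx hu hv; have R2 := runs_emit_vert (ready_upd (None :: stack s 0) hr) hx hu hv.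
have [hs _ _ _] := hr.
rewrite stack_upd eqxx upd_upd ?hs // in R2.
by apply: runs_le (runs_seq (runs_push _ _ _) R2); lia.
Qed.

Definition emit_triple (t : vert * vert * vert) : cmd :=
  Seq (emit_sep_vert t.2) (Seq (emit_sep_vert t.1.2) (emit_sep_vert t.1.1)).

Lemma runs_emit_triple t s u v B : ready s u v ->
  [/\ t.1.1 \in verts, t.1.2 \in verts & t.2 \in verts] -> 0 < u <= B -> 0 < v <= B ->
  runs (emit_triple t) s (upd s 0 (triple_word (place3 u v t) ++ stack s 0)) (78 * B).
Proof.
move=> hr [h1 h2 h3] hu hv; have [hs _ _ _] := hr.
have R1 := runs_emit_sep_vert hr h3 hu hv.
have R2 := runs_emit_sep_vert (ready_upd _ hr) h2 hu hv.
have R3 := runs_emit_sep_vert (ready_upd _ hr) h1 hu hv.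
move: (R2 (word (place u v t.2) ++ None :: stack s 0)).
rewrite stack_upd eqxx upd_upd ?hs // => {}R2.
move: (R3 (word (place u v t.1.2) ++ None :: word (place u v t.2) ++ None :: stack s 0)).
rewrite stack_upd eqxx upd_upd ?hs // => {}R3.
rewrite /triple_word /= -!(catA, cat_cons) /=.
by apply: runs_le (runs_seq R1 (runs_seq R2 R3)); lia.
Qed.

Definition emit_list (ts : seq (vert * vert * vert)) : cmd :=
  foldr (fun t => Seq (emit_triple t)) Skip ts.

Definition triple_words (ts : seq (nat * nat * nat)) : seq sym := flatten (map triple_word ts).

Lemma runs_emit_list ts s u v B : ready s u v ->
  (forall t, t \in ts -> [/\ t.1.1 \in verts, t.1.2 \in verts & t.2 \in verts]) ->
  0 < u <= B -> 0 < v <= B ->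
  runs (emit_list ts) s (upd s 0 (triple_words (rev (map (place3 u v) ts)) ++ stack s 0))
    (78 * B * size ts).
Proof.
move=> hr hts hu hv; elim: ts s hr hts => [|t ts IH] s hr hts.
  have [hs _ _ _] := hr; rewrite [_ ++ _]/(stack s 0) upd_id ?hs // muln0.
  exact: runs_skip.
rewrite [emit_list _]/= [map _ _]/= [size _]/=.
have R1 := runs_emit_triple hr (hts t (mem_head _ _)) hu hv.
have hts' t' : t' \in ts -> [/\ t'.1.1 \in verts, t'.1.2 \in verts & t'.2 \in verts].
  by move=> h; apply: hts; rewrite inE h orbT.
have R2 := IH _ (ready_upd (triple_word (place3 u v t) ++ stack s 0) hr) hts'.
have [hs _ _ _] := hr.
rewrite stack_upd eqxx upd_upd ?hs // in R2.
rewrite rev_cons /triple_words map_rcons flatten_rcons -catA.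
by apply: runs_le (runs_seq R1 R2); rewrite mulnS.
Qed.

(** * The program computing the reduction *)

(** The comparison walks through all of [n] even after a mismatch, because [n] is saved on the way
    for the next comparison. A symbol of [n] that differs from the top of [k] leaves [k] in place
    and counts as a mismatch. *)
Fixpoint leftover (n k : seq sym) : seq sym :=
  if n is a :: n' then leftover n' (if ohead k == Some a then behead k else k) else k.

Fixpoint mismatches (n k : seq sym) : nat :=
  if n is a :: n' then
    if ohead k == Some a then mismatches n' (behead k) else (mismatches n' k).+1
  else 0.

Lemma mismatches_eq0 n k : (mismatches n k + size (leftover n k) == 0) = (n == k).
Proof.
elim: n k => [|a n IH] [|b k] //=.
by rewrite (inj_eq Some_inj) eqseq_cons (eq_sym b a); case: (a == b).
Qed.

Lemma size_leftover n k : size (leftover n k) <= size k.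
Proof.
elim: n k => //= a n IH k; apply: leq_trans (IH _) _.
by case: ifP => // _; rewrite size_behead leq_pred.
Qed.

Lemma mismatches_le n k : mismatches n k <= size n.
Proof. by elim: n k => //= a n IH k; case: ifP => _; rewrite ?ltnS ?(leq_trans (IH _)). Qed.

Definition cmp_loop : cmd :=
  While (4, None, false) (on_top 4 (fun a => Seq (Pop 4) (Seq (Push 5 a)
    (If (6, Some a, true) (Pop 6) (Push 7 None))))).

Lemma runs_cmp_loop o a b x n nt k f u v t :
  runs cmp_loop [:: o; a; b; x; n; nt; k; f; u; v; t]
    [:: o; a; b; x; [::]; rev n ++ nt; leftover n k; nseq (mismatches n k) None ++ f; u; v; t]
    (11 * size n + 1).
Proof.
elim: n nt k f => [|c n IH] nt k f; first exact: runs_while_end.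
rewrite rev_cons cat_rcons [size _]/= [leftover _ _]/= [mismatches _ _]/=.
have R2 := IH (c :: nt) (if ohead k == Some c then behead k else k)
  (if ohead k == Some c then f else None :: f).
have -> : nseq (if ohead k == Some c then mismatches n (behead k) else (mismatches n k).+1) None ++ f =
  nseq (mismatches n (if ohead k == Some c then behead k else k)) None ++
  (if ohead k == Some c then f else None :: f).
  by case: ifP => // _; rewrite nseq_shift.
apply: runs_le (runs_while_step _ _ R2) => //; last first.
  apply: (@runs_on_top _ _ c n) => //.
  apply: runs_seq (runs_pop _ _) _; apply: runs_seq (runs_push _ _ _) _; apply: runs_if.
  rewrite /eval_test [stack _ _]/=; case: (ohead k == Some c); [exact: runs_pop|exact: runs_push].
by rewrite mulnS; lia.
Qed.

Definition cmp_tail : cmd := While (6, None, false) (Seq (Pop 6) (Push 7 None)).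

Lemma runs_cmp_tail o a b x n nt k f u v t :
  runs cmp_tail [:: o; a; b; x; n; nt; k; f; u; v; t]
    [:: o; a; b; x; n; nt; [::]; nseq (size k) None ++ f; u; v; t] (4 * size k + 1).
Proof.
elim: k f => [|c k IH] f; first exact: runs_while_end.
rewrite [size _]/= nseq_shift; apply: runs_le (runs_while_step _ _ (IH _)) => //; last first.
  by apply: runs_seq (runs_pop _ _) _; apply: runs_push.
by rewrite mulnS; lia.
Qed.

(** Leftover symbols become marks too, so emptiness of stack 7 decides equality. Stack 5 returns the
    outer name to stack 4. *)
Definition check_eq : cmd :=
  Seq cmp_loop (Seq cmp_tail (Seq (drain None false 5 [:: 4])
    (If (7, None, true) (emit_list eq_template) (drain None false 7 [::])))).

Lemma all_nonempty (w : seq sym) : all (fun a => (Some a == None) == false) w.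
Proof. exact/allP. Qed.

Lemma runs_check_eq o a b x n k u v M :
  0 < u <= M -> 0 < v <= M -> size n <= M -> size k <= M ->
  runs check_eq [:: o; a; b; x; n; [::]; k; [::]; word u; word v; [::]]
    [:: triple_words (rev (map (place3 u v) (if n == k then eq_template else [::]))) ++ o;
        a; b; x; n; [::]; [::]; [::]; word u; word v; [::]]
    (M * (37 + 78 * size eq_template) + 6).
Proof.
move=> hu hv hn hk.
have R1 := runs_cmp_loop o a b x n [::] k [::] (word u) (word v) [::].
rewrite !cats0 in R1.
have R2 := runs_cmp_tail o a b x [::] (rev n) (leftover n k)
  (nseq (mismatches n k) None) (word u) (word v) [::].
rewrite -nseqD in R2.
set fl := nseq (_ + _) _ in R2.
pose s := [:: o; a; b; x; [::]; rev n; [::]; fl; word u; word v; [::]].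
have R3 : runs (drain None false 5 [:: 4]) s
  [:: o; a; b; x; n; [::]; [::]; fl; word u; word v; [::]] (8 * size n + 1).
  have := @runs_drain None false 5 [:: 4] s (rev n) [::].
  rewrite size_rev => /(_ isT isT isT); rewrite cats0 => /(_ erefl (all_nonempty _) isT).
  by rewrite /s /= revK cats0.
have hl := size_leftover n k; have hm := mismatches_le n k.
have R4 : runs (If (7, None, true) (emit_list eq_template) (drain None false 7 [::]))
    [:: o; a; b; x; n; [::]; [::]; fl; word u; word v; [::]]
    [:: triple_words (rev (map (place3 u v) (if n == k then eq_template else [::]))) ++ o;
        a; b; x; n; [::]; [::]; [::]; word u; word v; [::]]
    ((78 * M * size eq_template + 7 * (size k + size n) + 1) + 2).
  have hf : size fl = size (leftover n k) + mismatches n k by rewrite size_nseq.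
  apply: runs_if.
  have -> : eval_test (7, None, true)
    [:: o; a; b; x; n; [::]; [::]; fl; word u; word v; [::]] = (n == k).
    by rewrite -mismatches_eq0 addnC -hf /eval_test [stack _ _]/=; case: (fl).
  case: ifP => [/eqP nk|nk].
    have f0 : fl = [::].
      by apply: size0nil; rewrite hf addnC; apply/eqP; rewrite mismatches_eq0 nk.
    have rdy : ready [:: o; a; b; x; n; [::]; [::]; fl; word u; word v; [::]] u v by [].
    have R := @runs_emit_list eq_template _ u v M rdy eq_template_verts hu hv.
    by rewrite f0 in R *; apply: (runs_le _ R); rewrite -addnA leq_addr.
  have := @runs_drain None false 7 [::] [:: o; a; b; x; n; [::]; [::]; fl; word u; word v; [::]] fl [::].
  rewrite cats0 => /(_ isT isT isT erefl (all_nonempty _) isT); apply: runs_le.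
  by rewrite hf [size [::]]/=; lia.
apply: runs_le (runs_seq R1 (runs_seq R2 (runs_seq R3 R4))).
have h1 := leq_trans hl hk.
move: (size eq_template) (size n) (size k) (size (leftover n k)) hn hk h1 => Z n' k' l' ? ? ?.
nia.
Qed.

Definition enc_name (a : nat) : seq sym := word a ++ [:: None].
Definition enc_names (s : seq nat) : seq sym := flatten (map enc_name s).

Lemma word_bits n : all (fun a => (Some a == Some None) == false) (word n).
Proof. by rewrite /word; elim: (bits n). Qed.

(** The name is copied to stack 6 for the comparison, which destroys it, and to stack 3, from which
    [outer_body] restores the list. *)
Definition inner_body : cmd :=
  Seq (drain (Some None) false 2 [:: 3; 6]) (Seq (Pop 2) (Seq (Push 3 None) (Seq (inc 9)
    (Seq (emit_list pair_template) check_eq)))).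

Definition inner_cost : nat := 100 + 78 * (size pair_template + size eq_template).

Lemma runs_inner_body o a b x u p v q M :
  0 < u <= M -> v < M -> size (word p) <= M -> size (word q) <= M ->
  runs inner_body
    [:: o; a; enc_name q ++ b; x; rev (word p); [::]; [::]; [::]; word u; word v; [::]]
    [:: triple_words (rev (pair_cons (u, p) (v.+1, q))) ++ o; a; b; rev (enc_name q) ++ x;
        rev (word p); [::]; [::]; [::]; word u; word v.+1; [::]]
    (inner_cost * M).
Proof.
move=> hu hv hp hq.
pose s0 := [:: o; a; word q ++ None :: b; x; rev (word p); [::]; [::]; [::]; word u; word v; [::]].
have R1 : runs (drain (Some None) false 2 [:: 3; 6]) s0
   [:: o; a; None :: b; rev (word q) ++ x; rev (word p); [::]; rev (word q); [::]; word u; word v; [::]]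
   (9 * size (word q) + 1).
  have := @runs_drain (Some None) false 2 [:: 3; 6] s0 (word q) (None :: b) isT isT isT erefl
    (word_bits q) isT.
  by rewrite /= cats0.
have R2 : runs (Pop 2)
   [:: o; a; None :: b; rev (word q) ++ x; rev (word p); [::]; rev (word q); [::]; word u; word v; [::]]
   [:: o; a; b; rev (word q) ++ x; rev (word p); [::]; rev (word q); [::]; word u; word v; [::]] 1.
  exact: runs_pop.
have R3 : runs (Push 3 None)
   [:: o; a; b; rev (word q) ++ x; rev (word p); [::]; rev (word q); [::]; word u; word v; [::]]
   [:: o; a; b; None :: rev (word q) ++ x; rev (word p); [::]; rev (word q); [::]; word u; word v; [::]] 1.
  exact: runs_push.
have R4 : runs (inc 9)
   [:: o; a; b; None :: rev (word q) ++ x; rev (word p); [::]; rev (word q); [::]; word u; word v; [::]]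
   [:: o; a; b; None :: rev (word q) ++ x; rev (word p); [::]; rev (word q); [::]; word u; word v.+1; [::]]
   (12 * v + 6).
  exact: runs_inc.
have hv' : 0 < v.+1 <= M by [].
have rdy : ready [:: o; a; b; None :: rev (word q) ++ x; rev (word p); [::]; rev (word q); [::];
    word u; word v.+1; [::]] u v.+1 by [].
have R5 := @runs_emit_list pair_template _ u v.+1 M rdy pair_template_verts hu hv'.
have R6 := @runs_check_eq (triple_words (rev (map (place3 u v.+1) pair_template)) ++ o) a b
  (None :: rev (word q) ++ x) (rev (word p)) (rev (word q)) u v.+1 M hu hv'.
rewrite !size_rev in R6; have {}R6 := R6 hp hq.
(* Both names are stored reversed; as [rev] and [word] are injective, equal stacks mean equal
   variables. *)
have e1 : rev (pair_cons (u, p) (v.+1, q)) =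
    rev (map (place3 u v.+1) (if rev (word p) == rev (word q) then eq_template else [::])) ++
    rev (map (place3 u v.+1) pair_template).
  rewrite (inj_eq (can_inj revK)) (inj_eq word_inj) /pair_cons map_cat rev_cat.
  by congr (_ ++ _).
have e2 : rev (enc_name q) ++ x = None :: rev (word q) ++ x.
  by rewrite /enc_name rev_cat.
have e3 : enc_name q ++ b = word q ++ None :: b by rewrite /enc_name -catA.
rewrite e1 e2 e3 /triple_words map_cat flatten_cat -catA.
apply: runs_le (runs_seq R1 (runs_seq R2 (runs_seq R3 (runs_seq R4 (runs_seq R5 R6))))).
rewrite /inner_cost; move: (size eq_template) (size pair_template) (size (word q)) hq => Z Y q' hq.
nia.
Qed.

Definition inner_loop : cmd := While (2, None, false) inner_body.

Lemma enc_names_nonempty c cs : exists s w, enc_names (c :: cs) = s :: w.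
Proof. by rewrite /enc_names /enc_name /=; case: (word c) => [|s w] /=; eexists; eexists. Qed.

Lemma runs_inner_loop cs o a x u p v M :
  0 < u <= M -> v + size cs <= M -> size (word p) <= M ->
  (forall q, q \in cs -> size (word q) <= M) ->
  runs inner_loop
    [:: o; a; enc_names cs; x; rev (word p); [::]; [::]; [::]; word u; word v; [::]]
    [:: triple_words (rev (flatten [seq pair_cons (u, p) q | q <- zip (iota v.+1 (size cs)) cs])) ++ o;
        a; [::]; rev (enc_names cs) ++ x;
        rev (word p); [::]; [::]; [::]; word u; word (v + size cs); [::]]
    ((inner_cost * M + 2) * size cs + 1).
Proof.
move=> hu + hp; elim: cs o x v => [|q cs IH] o x v hv hq.
  by rewrite [size _]/= addn0 muln0; apply: runs_while_end.
have R1 := @runs_inner_body o a (enc_names cs) x u p v q M hu _ hp (hq q (mem_head _ _)).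
have R2 := IH (triple_words (rev (pair_cons (u, p) (v.+1, q))) ++ o) (rev (enc_name q) ++ x) v.+1.
have vM : v < M by move: hv => /=; lia.
have hv' : v.+1 + size cs <= M by move: hv => /=; lia.
have hq' q' : q' \in cs -> size (word q') <= M by move=> h; apply: hq; rewrite inE h orbT.
have {}R1 := R1 vM; have {}R2 := R2 hv' hq'.
have -> : rev (enc_names (q :: cs)) ++ x = rev (enc_names cs) ++ rev (enc_name q) ++ x.
  by rewrite [enc_names (q :: cs)]/(enc_name q ++ enc_names cs) rev_cat catA.
have -> : v + size (q :: cs) = v.+1 + size cs by rewrite addSnnS.
have -> : rev (flatten [seq pair_cons (u, p) q0 | q0 <- zip (iota v.+1 (size (q :: cs))) (q :: cs)]) =
   rev (flatten [seq pair_cons (u, p) q0 | q0 <- zip (iota v.+2 (size cs)) cs]) ++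
   rev (pair_cons (u, p) (v.+1, q)) by rewrite -rev_cat.
rewrite {1}/triple_words map_cat flatten_cat -catA.
have [s [w e]] := enc_names_nonempty q cs.
apply: runs_le (runs_while_step _ R1 R2).
  by rewrite [size (q :: cs)]/= mulnS; move: (inner_cost * M) => A; move: ((A + 2) * size cs) => B; lia.
by rewrite /eval_test [stack _ _]e.
Qed.

Definition outer_body : cmd :=
  Seq (drain (Some None) false 1 [:: 4]) (Seq (Pop 1) (Seq (inc 8) (Seq inner_loop
   (Seq (drain None false 3 [:: 2]) (Seq (drain None false 9 [::]) (drain None false 4 [::])))))).

Lemma runs_outer_body cs o a p u M :
  u < M -> size cs <= M -> size (word p) <= M -> size (enc_names cs) <= M ->
  (forall q, q \in cs -> size (word q) <= M) ->
  runs outer_body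
    [:: o; enc_name p ++ a; enc_names cs; [::]; [::]; [::]; [::]; [::]; word u; [::]; [::]]
    [:: triple_words (rev (flatten [seq pair_cons (u.+1, p) q | q <- zip (iota 1 (size cs)) cs])) ++ o;
        a; enc_names cs; [::]; [::]; [::]; [::]; [::]; word u.+1; [::]; [::]]
    ((inner_cost + 55) * M * M).
Proof.
move=> hu hcs hp he hq; rewrite /enc_name -catA.
have uM : 0 < u.+1 <= M by [].
have R1 : runs (drain (Some None) false 1 [:: 4])
  [:: o; word p ++ None :: a; enc_names cs; [::]; [::]; [::]; [::]; [::]; word u; [::]; [::]]
  [:: o; None :: a; enc_names cs; [::]; rev (word p); [::]; [::]; [::]; word u; [::]; [::]]
  (8 * size (word p) + 1).
  have := @runs_drain (Some None) false 1 [:: 4]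
   [:: o; word p ++ None :: a; enc_names cs; [::]; [::]; [::]; [::]; [::]; word u; [::]; [::]]
   (word p) (None :: a) isT isT isT erefl (word_bits p) isT.
  by rewrite /= cats0.
have R2 : runs (Pop 1)
  [:: o; None :: a; enc_names cs; [::]; rev (word p); [::]; [::]; [::]; word u; [::]; [::]]
  [:: o; a; enc_names cs; [::]; rev (word p); [::]; [::]; [::]; word u; [::]; [::]] 1.
  exact: runs_pop.
have R3 : runs (inc 8)
  [:: o; a; enc_names cs; [::]; rev (word p); [::]; [::]; [::]; word u; [::]; [::]]
  [:: o; a; enc_names cs; [::]; rev (word p); [::]; [::]; [::]; word u.+1; [::]; [::]] (12 * u + 6).
  exact: runs_inc.
have R4 := @runs_inner_loop cs o a [::] u.+1 p 0 M uM hcs hp hq.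
rewrite cats0 add0n in R4; set o' := triple_words _ ++ o in R4 *.
have R5 : runs (drain None false 3 [:: 2])
  [:: o'; a; [::]; rev (enc_names cs); rev (word p); [::]; [::]; [::]; word u.+1; word (size cs); [::]]
  [:: o'; a; enc_names cs; [::]; rev (word p); [::]; [::]; [::]; word u.+1; word (size cs); [::]]
  (8 * size (enc_names cs) + 1).
  have := @runs_drain None false 3 [:: 2]
    [:: o'; a; [::]; rev (enc_names cs); rev (word p); [::]; [::]; [::]; word u.+1; word (size cs); [::]]
    (rev (enc_names cs)) [::] isT isT isT (esym (cats0 _)) (all_nonempty _) isT.
  by rewrite /= revK cats0 size_rev.
have R6 : runs (drain None false 9 [::])
  [:: o'; a; enc_names cs; [::]; rev (word p); [::]; [::]; [::]; word u.+1; word (size cs); [::]]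
  [:: o'; a; enc_names cs; [::]; rev (word p); [::]; [::]; [::]; word u.+1; [::]; [::]]
  (7 * size (word (size cs)) + 1).
  exact: (@runs_drain None false 9 [::]
  [:: o'; a; enc_names cs; [::]; rev (word p); [::]; [::]; [::]; word u.+1; word (size cs); [::]]
    (word (size cs)) [::] isT isT isT (esym (cats0 _)) (all_nonempty _) isT).
have R7 : runs (drain None false 4 [::])
  [:: o'; a; enc_names cs; [::]; rev (word p); [::]; [::]; [::]; word u.+1; [::]; [::]]
  [:: o'; a; enc_names cs; [::]; [::]; [::]; [::]; [::]; word u.+1; [::]; [::]]
  (7 * size (rev (word p)) + 1).
  exact: (@runs_drain None false 4 [::]
  [:: o'; a; enc_names cs; [::]; rev (word p); [::]; [::]; [::]; word u.+1; [::]; [::]]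
    (rev (word p)) [::] isT isT isT (esym (cats0 _)) (all_nonempty _) isT).
apply: runs_le (runs_seq R1 (runs_seq R2 (runs_seq R3 (runs_seq R4 (runs_seq R5 (runs_seq R6 R7)))))).
rewrite size_rev; have := leq_trans (size_word (size cs)) hcs.
move: inner_cost (size cs) (size (word p)) (size (enc_names cs)) (size (word (size cs))) hcs hp he => C c p' e' w' h1 h2 h3 h4.
have h5 : (C * M + 2) * c <= (C * M + 2) * M by rewrite leq_mul2l h1 orbT.
nia.
Qed.

Definition outer_loop : cmd := While (1, None, false) outer_body.

Lemma runs_outer_loop ps cs o u M :
  u + size ps <= M -> size cs <= M -> size (enc_names cs) <= M ->
  (forall q, q \in cs -> size (word q) <= M) ->
  (forall q, q \in ps -> size (word q) <= M) ->
  runs outer_loop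
    [:: o; enc_names ps; enc_names cs; [::]; [::]; [::]; [::]; [::]; word u; [::]; [::]]
    [:: triple_words (rev (flatten [seq flatten [seq pair_cons p q | q <- zip (iota 1 (size cs)) cs]
          | p <- zip (iota u.+1 (size ps)) ps])) ++ o;
        [::]; enc_names cs; [::]; [::]; [::]; [::]; [::]; word (u + size ps); [::]; [::]]
    (((inner_cost + 55) * M * M + 2) * size ps + 1).
Proof.
move=> + hcs he hq; elim: ps o u => [|p ps IH] o u hu hp.
  by rewrite [size _]/= addn0 muln0; apply: runs_while_end.
have uM : u < M by move: hu => /=; lia.
have hu' : u.+1 + size ps <= M by move: hu => /=; lia.
have hp' q' : q' \in ps -> size (word q') <= M by move=> h; apply: hp; rewrite inE h orbT.
have R1 := @runs_outer_body cs o (enc_names ps) p u M uM hcs (hp p (mem_head _ _)) he hq.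
have R2 := IH _ u.+1 hu' hp'.
have -> : u + size (p :: ps) = u.+1 + size ps by rewrite addSnnS.
have -> : rev (flatten [seq flatten [seq pair_cons p0 q | q <- zip (iota 1 (size cs)) cs]
          | p0 <- zip (iota u.+1 (size (p :: ps))) (p :: ps)]) =
   rev (flatten [seq flatten [seq pair_cons p0 q | q <- zip (iota 1 (size cs)) cs]
          | p0 <- zip (iota u.+2 (size ps)) ps]) ++
   rev (flatten [seq pair_cons (u.+1, p) q | q <- zip (iota 1 (size cs)) cs]) by rewrite -rev_cat.
rewrite {1}/triple_words map_cat flatten_cat -catA.
have [s [w e]] := enc_names_nonempty p ps.
apply: runs_le (runs_while_step _ R1 (R2 _)).
  rewrite [size (p :: ps)]/= mulnS; move: ((inner_cost + 55) * M * M) => A.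
  by move: ((A + 2) * size ps) => B; lia.
by rewrite /eval_test [stack _ _]e.
Qed.

Definition clause_step (k : nat) : cmd :=
  Seq (drain (Some None) false 2 [:: 3]) (Seq (Pop 2) (Seq (Push 3 None) (Seq (inc 9)
    (Seq (Push 0 None) (Seq (emit_num 9) (push_word (map Some (bits3 k)))))))).

Lemma runs_clause_step k q v o a b x M : k < 8 -> v < M -> size (word q) <= M ->
  runs (clause_step k)
    [:: o; a; enc_name q ++ b; x; [::]; [::]; [::]; [::]; [::]; word v; [::]]
    [:: word (8 * v.+1 + k) ++ None :: o; a; b; rev (enc_name q) ++ x;
        [::]; [::]; [::]; [::]; [::]; word v.+1; [::]] (60 * M).
Proof.
move=> hk hv hq.
have -> : rev (enc_name q) ++ x = None :: rev (word q) ++ x by rewrite /enc_name rev_cat.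
have -> : enc_name q ++ b = word q ++ None :: b by rewrite /enc_name -catA.
have R1 : runs (drain (Some None) false 2 [:: 3])
  [:: o; a; word q ++ None :: b; x; [::]; [::]; [::]; [::]; [::]; word v; [::]]
  [:: o; a; None :: b; rev (word q) ++ x; [::]; [::]; [::]; [::]; [::]; word v; [::]]
  (8 * size (word q) + 1).
  exact: (@runs_drain (Some None) false 2 [:: 3]
    [:: o; a; word q ++ None :: b; x; [::]; [::]; [::]; [::]; [::]; word v; [::]]
    (word q) (None :: b) isT isT isT erefl (word_bits q) isT).
have R2 : runs (Pop 2)
  [:: o; a; None :: b; rev (word q) ++ x; [::]; [::]; [::]; [::]; [::]; word v; [::]]
  [:: o; a; b; rev (word q) ++ x; [::]; [::]; [::]; [::]; [::]; word v; [::]] 1.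
  exact: runs_pop.
have R3 : runs (Push 3 None)
  [:: o; a; b; rev (word q) ++ x; [::]; [::]; [::]; [::]; [::]; word v; [::]]
  [:: o; a; b; None :: rev (word q) ++ x; [::]; [::]; [::]; [::]; [::]; word v; [::]] 1.
  exact: runs_push.
have R4 : runs (inc 9)
  [:: o; a; b; None :: rev (word q) ++ x; [::]; [::]; [::]; [::]; [::]; word v; [::]]
  [:: o; a; b; None :: rev (word q) ++ x; [::]; [::]; [::]; [::]; [::]; word v.+1; [::]] (12 * v + 6).
  exact: runs_inc.
have R5 : runs (Push 0 None)
  [:: o; a; b; None :: rev (word q) ++ x; [::]; [::]; [::]; [::]; [::]; word v.+1; [::]]
  [:: None :: o; a; b; None :: rev (word q) ++ x; [::]; [::]; [::]; [::]; [::]; word v.+1; [::]] 1.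
  exact: runs_push.
have R6 := @runs_emit_block 9 v.+1 k
  [:: None :: o; a; b; None :: rev (word q) ++ x; [::]; [::]; [::]; [::]; [::]; word v.+1; [::]]
  M isT isT isT isT erefl erefl hv hk.
apply: runs_le (runs_seq R1 (runs_seq R2 (runs_seq R3 (runs_seq R4 (runs_seq R5 R6))))).
move: (size (word q)) hq => q' hq; lia.
Qed.

Definition clause_loop : cmd :=
  While (2, None, false) (Seq (clause_step 3) (Seq (clause_step 1) (clause_step 5))).

Lemma runs_clause_loop I o a x j M :
  3 * (j + size I) <= M -> (forall q, q \in occs I -> size (word q) <= M) ->
  runs clause_loop
    [:: o; a; enc_names (occs I); x; [::]; [::]; [::]; [::]; [::]; word (3 * j); [::]]
    [:: triple_words (rev [seq clause_con (3 * i) | i <- iota j (size I)]) ++ o; a; [::];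
        rev (enc_names (occs I)) ++ x; [::]; [::]; [::]; [::]; [::]; word (3 * (j + size I)); [::]]
    ((180 * M + 2) * size I + 1).
Proof.
elim: I o x j => [|t I IH] o x j hj hq.
  by rewrite [size _]/= addn0 muln0; apply: runs_while_end.
have -> : occs (t :: I) = [:: t.1.1, t.1.2, t.2 & occs I] by [].
have q1 : size (word t.1.1) <= M by apply: hq; rewrite !inE eqxx.
have q2 : size (word t.1.2) <= M by apply: hq; rewrite !inE eqxx orbT.
have q3 : size (word t.2) <= M by apply: hq; rewrite !inE eqxx !orbT.
have v3 : (3 * j).+2 < M by move: hj => /=; lia.
have v2 : (3 * j).+1 < M by apply: ltnW.
have v1 : 3 * j < M by apply: ltnW.
have R1 := @runs_clause_step 3 t.1.1 (3 * j) o a (enc_names [:: t.1.2, t.2 & occs I]) x M isT v1 q1.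
have R2 := @runs_clause_step 1 t.1.2 (3 * j).+1 (word (8 * (3 * j).+1 + 3) ++ None :: o) a
  (enc_names (t.2 :: occs I)) (rev (enc_name t.1.1) ++ x) M isT v2 q2.
have R3 := @runs_clause_step 5 t.2 (3 * j).+2
  (word (8 * (3 * j).+2 + 1) ++ None :: word (8 * (3 * j).+1 + 3) ++ None :: o) a
  (enc_names (occs I)) (rev (enc_name t.1.2) ++ rev (enc_name t.1.1) ++ x) M isT v3 q3.
have hj' : 3 * (j.+1 + size I) <= M by move: hj => /=; lia.
have hq' q : q \in occs I -> size (word q) <= M.
  by move=> h; apply: hq; rewrite !inE h !orbT.
have e3 : (3 * j).+3 = 3 * j.+1 by lia.
rewrite e3 in R3.
have R4 := IH (triple_word (clause_con (3 * j)) ++ o)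
  (rev (enc_name t.2) ++ rev (enc_name t.1.2) ++ rev (enc_name t.1.1) ++ x) j.+1 hj' hq'.
have -> : rev (enc_names [:: t.1.1, t.1.2, t.2 & occs I]) ++ x =
  rev (enc_names (occs I)) ++ rev (enc_name t.2) ++ rev (enc_name t.1.2) ++ rev (enc_name t.1.1) ++ x.
  have -> : enc_names [:: t.1.1, t.1.2, t.2 & occs I] =
    enc_name t.1.1 ++ enc_name t.1.2 ++ enc_name t.2 ++ enc_names (occs I) by [].
  by rewrite !rev_cat -!catA.
have -> : j + size (t :: I) = j.+1 + size I by rewrite addSnnS.
have -> : rev [seq clause_con (3 * i) | i <- iota j (size (t :: I))] =
  rev [seq clause_con (3 * i) | i <- iota j.+1 (size I)] ++ [:: clause_con (3 * j)].
  by rewrite [iota _ _]/= map_cons rev_cons cats1.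
have -> : triple_words (rev [seq clause_con (3 * i) | i <- iota j.+1 (size I)] ++ [:: clause_con (3 * j)]) =
  triple_words (rev [seq clause_con (3 * i) | i <- iota j.+1 (size I)]) ++ triple_word (clause_con (3 * j)).
  by rewrite /triple_words map_cat flatten_cat /= cats0.
rewrite -catA.
have e : triple_word (clause_con (3 * j)) ++ o =
  word (8 * 3 * j.+1 + 5) ++ None :: word (8 * (3 * j).+2 + 1) ++ None :: word (8 * (3 * j).+1 + 3) ++ None :: o.
  rewrite /triple_word /clause_con /place [nth _ _ _]/= -!(catA, cat_cons) /=.
  by rewrite e3 mulnA.
rewrite e -mulnA in R4 *.
have [s [w ew]] := enc_names_nonempty t.1.1 [:: t.1.2, t.2 & occs I].
apply: runs_le (runs_while_step _ (runs_seq R1 (runs_seq R2 R3)) R4).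
  by rewrite [size (t :: I)]/= mulnS; lia.
by rewrite /eval_test [stack _ _]ew.
Qed.

Definition clear (i : nat) : cmd := drain None false i [::].

(** The number of variables heads the output and is therefore pushed last: after the outer loop
    stack 8 holds the number of occurrences, the increment accounts for block 0, and three zero bits
    multiply by 8. Passing through stack 3 gives two copies of the input in the original order. *)
Definition reduce_cmd : cmd :=
  Seq (drain None false 0 [:: 3]) (Seq (drain None false 3 [:: 1; 2])
  (Seq clause_loop (Seq (drain None false 3 [:: 2]) (Seq (clear 9) (Seq outer_loop
  (Seq (inc 8) (Seq (Push 0 None) (Seq (emit_num 8) (Seq (push_word (map Some (bits3 0)))
  (Seq (clear 8) (clear 2))))))))))).

Lemma wf_emit_list ts : wf_cmd 11 (emit_list ts).
Proof.
have hw w : wf_cmd 11 (push_word w) by elim: w => //= a w ->.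
have hs x : wf_cmd 11 (emit_sep_vert x).
  rewrite /emit_sep_vert /emit_vert; case: ifP => _; first by rewrite /= hw.
  by case: ifP.
elim: ts => // t ts IH.
have -> : wf_cmd 11 (emit_list (t :: ts)) = [&& wf_cmd 11 (emit_sep_vert t.2),
  wf_cmd 11 (emit_sep_vert t.1.2) & wf_cmd 11 (emit_sep_vert t.1.1)] && wf_cmd 11 (emit_list ts) by [].
by rewrite !hs IH.
Qed.

Lemma wf_reduce : wf_cmd 11 reduce_cmd.
Proof.
have e1 := wf_emit_list eq_template; have e2 := wf_emit_list pair_template.
by rewrite /= e1 e2.
Qed.

Definition scsp_word (J : scsp_inst) : seq sym := word J.1 ++ None :: triple_words J.2.

Lemma runs_drain1 i j s s' w : i != j -> i < size s -> j < size s -> stack s i = w ->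
  s' = upd (upd s j (rev w ++ stack s j)) i [::] ->
  runs (drain None false i [:: j]) s s' (8 * size w + 1).
Proof.
move=> hij hi hj e ->.
have := @runs_drain None false i [:: j] s w [::] hi.
by rewrite /= hj inE hij cats0; apply=> //; apply: all_nonempty.
Qed.

Lemma runs_clear i s s' w : i < size s -> stack s i = w -> s' = upd s i [::] ->
  runs (clear i) s s' (7 * size w + 1).
Proof.
move=> hi e ->; have := @runs_drain None false i [::] s w [::] hi.
by rewrite cats0; apply=> //; apply: all_nonempty.
Qed.

Lemma size_enc_names s : size s <= size (enc_names s).
Proof.
elim: s => //= a s IH; rewrite /enc_names /= size_cat -/(enc_names s) size_cat /=; lia.
Qed.

Lemma size_name_le s q : q \in s -> size (word q) <= size (enc_names s).
Proof.
elim: s => //= a s IH; rewrite inE /enc_names /= -/(enc_names s) !size_cat => /orP[/eqP ->|/IH h].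
  by rewrite -addnA leq_addr.
by apply: leq_trans h _; apply: leq_addl.
Qed.

(** At most [M] outer rounds with at most [M] inner rounds each, and an inner round is linear in
    [M]: the templates have constant size, and the length of a counter is crudely bounded by its
    value. *)
Lemma runs_reduce I M : (size (enc_names (occs I))).+1 = M ->
  runs reduce_cmd (enc_names (occs I) :: nseq 10 [::]) (scsp_word (reduction I) :: nseq 10 [::])
    ((inner_cost + 500) * M * M * M).
Proof.
move=> eM; set cs := occs I; set w := enc_names cs; rewrite -/cs -/w in eM.
have wM : size w <= M by rewrite -eM.
have csM : size cs <= M by rewrite (leq_trans (size_enc_names _)).
have nM q : q \in cs -> size (word q) <= M by move=> h; apply: leq_trans (size_name_le h) wM.
have csI : size cs = 3 * size I by rewrite size_occs.
have R1 : runs (drain None false 0 [:: 3]) (w :: nseq 10 [::])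
  [:: [::]; [::]; [::]; rev w; [::]; [::]; [::]; [::]; [::]; [::]; [::]] (8 * size w + 1).
  by apply: runs_drain1; rewrite //= cats0.
have R2 : runs (drain None false 3 [:: 1; 2])
  [:: [::]; [::]; [::]; rev w; [::]; [::]; [::]; [::]; [::]; [::]; [::]]
  [:: [::]; w; w; [::]; [::]; [::]; [::]; [::]; [::]; [::]; [::]] (9 * size w + 1).
  have := @runs_drain None false 3 [:: 1; 2]
    [:: [::]; [::]; [::]; rev w; [::]; [::]; [::]; [::]; [::]; [::]; [::]] (rev w) [::]
    isT isT isT (esym (cats0 _)) (all_nonempty _) isT.
  by rewrite /= revK cats0 size_rev.
have hI : 3 * (0 + size I) <= M by rewrite add0n -csI.
have R3 := @runs_clause_loop I [::] w [::] 0 M hI nM.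
rewrite -/cs -/w !cats0 add0n -csI in R3.
set o1 := triple_words _ in R3.
have R4 : runs (drain None false 3 [:: 2])
  [:: o1; w; [::]; rev w; [::]; [::]; [::]; [::]; [::]; word (size cs); [::]]
  [:: o1; w; w; [::]; [::]; [::]; [::]; [::]; [::]; word (size cs); [::]] (8 * size (rev w) + 1).
  by apply: runs_drain1; rewrite //= revK cats0.
have R5 : runs (clear 9)
  [:: o1; w; w; [::]; [::]; [::]; [::]; [::]; [::]; word (size cs); [::]]
  [:: o1; w; w; [::]; [::]; [::]; [::]; [::]; [::]; [::]; [::]] (7 * size (word (size cs)) + 1).
  exact: runs_clear.
have R6 := @runs_outer_loop cs cs o1 0 M csM csM wM nM nM.
rewrite -/w add0n in R6; set o2 := triple_words _ ++ o1 in R6.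
have R7 : runs (inc 8)
  [:: o2; [::]; w; [::]; [::]; [::]; [::]; [::]; word (size cs); [::]; [::]]
  [:: o2; [::]; w; [::]; [::]; [::]; [::]; [::]; word (size cs).+1; [::]; [::]] (12 * size cs + 6).
  exact: runs_inc.
have R8 : runs (Push 0 None)
  [:: o2; [::]; w; [::]; [::]; [::]; [::]; [::]; word (size cs).+1; [::]; [::]]
  [:: None :: o2; [::]; w; [::]; [::]; [::]; [::]; [::]; word (size cs).+1; [::]; [::]] 1.
  exact: runs_push.
have R9 := @runs_emit_num 8
  [:: None :: o2; [::]; w; [::]; [::]; [::]; [::]; [::]; word (size cs).+1; [::]; [::]]
  _ isT isT isT isT erefl erefl.
have R10 := @runs_push_word (map Some (bits3 0))
  [:: word (size cs).+1 ++ None :: o2; [::]; w; [::]; [::]; [::]; [::]; [::]; word (size cs).+1; [::]; [::]] isT.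
rewrite [X in runs _ _ _ X](erefl : _ = 3) in R10.
set o3 := _ ++ stack _ _ in R10.
have R11 : runs (clear 8)
  [:: o3; [::]; w; [::]; [::]; [::]; [::]; [::]; word (size cs).+1; [::]; [::]]
  [:: o3; [::]; w; [::]; [::]; [::]; [::]; [::]; [::]; [::]; [::]] (7 * size (word (size cs).+1) + 1).
  exact: runs_clear.
have R12 : runs (clear 2)
  [:: o3; [::]; w; [::]; [::]; [::]; [::]; [::]; [::]; [::]; [::]]
  (o3 :: nseq 10 [::]) (7 * size w + 1).
  exact: runs_clear.
have -> : scsp_word (reduction I) = o3.
  rewrite /scsp_word /o3 [stack _ _]/= catA -word_block // addn0; congr (_ ++ _ :: _).
  by rewrite /reduction /= rev_cat /triple_words map_cat flatten_cat.
apply: runs_le (runs_seq R1 (runs_seq R2 (runs_seq R3 (runs_seq R4 (runs_seq R5 (runs_seq R6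
  (runs_seq R7 (runs_seq R8 (runs_seq R9 (runs_seq R10 (runs_seq R11 R12))))))))))).
rewrite size_rev; have h1 := leq_trans (size_word (size cs)) csM.
have h2 : size (word (size cs).+1) <= M.+1 by apply: leq_trans (size_word _) _.
have h3 : size I <= M by apply: leq_trans csM; rewrite csI; lia.
move: inner_cost (size cs) (size w) (size I) (size (word (size cs))) (size (word (size cs).+1)) csM wM h1 h2 h3.
move=> C c l i a b hc hl ha hb hi.
have M0 : 0 < M by rewrite -eM.
have g1 : (180 * M + 2) * i <= 180 * (M * M) + 2 * M.
  by rewrite mulnA -mulnDl leq_mul2l hi orbT.
have -> : (C + 500) * M * M * M = (C + 55) * M * M * M + 445 * (M * M * M).
  by rewrite -!mulnA -mulnDl -addnA.
move: ((C + 55) * M * M) => A.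
have g2 : (A + 2) * c <= A * M + 2 * M by rewrite -mulnDl leq_mul2l hc orbT.
have g3 : M <= M * M by rewrite leq_pmulr.
have g4 : M * M <= M * M * M by rewrite leq_pmulr.
move: ((A + 2) * c) (A * M) (M * M * M) (M * M) ((180 * M + 2) * i) g1 g2 g3 g4.
move=> X Y Z W V g1 g2 g3 g4; lia.
Qed.

(** Every number in the input ends with a separator, so a list of triples and the flat list of its
    occurrences have the same encoding. *)
Lemma code_enc_names I : map code_sym (enc_names (occs I)) = enc_csp I.
Proof.
rewrite /enc_names /occs /enc_csp; elim: I => //= t I <-.
rewrite /enc_name /enc_triple !map_cat !code_word -!catA.
by rewrite /= -!catA /= -!catA.
Qed.

Lemma code_scsp_word J : map code_sym (scsp_word J) = enc_scsp J.
Proof.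
rewrite /scsp_word /enc_scsp map_cat code_word /=; congr (_ ++ _ :: _).
rewrite /triple_words; elim: J.2 => //= t I <-; rewrite map_cat; congr (_ ++ _).
by rewrite /triple_word /enc_triple map_cat /= map_cat /= map_cat !code_word.
Qed.

(** * Unique decoding of the output, and the final time bound *)

Lemma code_sym_inj : injective code_sym.
Proof. by move=> [[]|] [[]|]. Qed.

Lemma split_sep (w1 w2 : seq bool) (r1 r2 : seq sym) :
  map Some w1 ++ None :: r1 = map Some w2 ++ None :: r2 -> w1 = w2 /\ r1 = r2.
Proof.
elim: w1 w2 => [|a w1 IH] [|b w2] //=; first by case.
by case=> -> /IH[-> ->].
Qed.

Lemma word_split m n r1 r2 : word m ++ None :: r1 = word n ++ None :: r2 -> m = n /\ r1 = r2.
Proof. by case/split_sep=> /bits_inj -> ->. Qed.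

Lemma triple_words_inj : injective triple_words.
Proof.
have ne t : triple_words t = [::] -> t = [::].
  by case: t => // -[[x y] z] t; rewrite /triple_words /= /triple_word /=; case: (word x).
elim=> [|[[x y] z] s IH] [|[[x' y'] z'] s'] //.
- by move/esym/ne.
- by move/ne.
rewrite /triple_words /= /triple_word /= -!catA /= -!catA /= -!catA /=.
by move=> /word_split[-> /word_split[-> /word_split[-> /IH ->]]].
Qed.

(** [L_scsp] accepts a word if some instance with this encoding is satisfiable; injectivity
    identifies that instance with the reduction. *)
Lemma enc_scsp_inj : injective enc_scsp.
Proof.
move=> [m J] [n J']; rewrite -!code_scsp_word => /(inj_map code_sym_inj).
by case/word_split=> /= -> /triple_words_inj ->.
Qed.

Theorem theorem4p3 : csp_NAE3_poly_reducible_to_scsp_N.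
Proof.
pose C := inner_cost + 500.
(* The program executes at most [C * M ^ 3] instructions. Each takes a number of tape steps linear
   in the heights of the stacks, which are bounded by the input length plus the number of
   instructions; hence the exponent 6. The summand 2 pays for placing the marker. *)
exists (track_machine 10 (compile reduce_cmd 0)), (2 + C * (2 * C + 6)), 6 => I.
exists (enc_scsp (reduction I)); split; last first.
  split=> [[J [/enc_scsp_inj <- [_]]]|sat]; first exact: reduction_sound.
  by exists (reduction I); split=> //; split; [exact: reduction_wf|exact: reduction_complete].
rewrite -code_enc_names -code_scsp_word size_map.
set w := enc_names _; set M := (size w).+1.
have [t ht he] := runs_reduce (erefl M).
have [s hs hc] := exec_computes wf_reduce he.
exists s => //; apply: leq_trans hs _; rewrite -/w.
have {}ht : t <= C * M ^ 3 by rewrite /C; move: ht; rewrite -!mulnA.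
have M3 : M <= M ^ 3 by rewrite -{1}(expn1 M) leq_pexp2l.
have M1 : 1 <= M ^ 6 by rewrite expn_gt0.
have e : M ^ 6 = M ^ 3 * M ^ 3 by rewrite -expnD.
have h2 : 2 * (size w + t) + 4 <= (2 * C + 6) * M ^ 3.
  have wM : size w < M by [].
  rewrite mulnDl -mulnA; move: (M ^ 3) M3 ht => Y hY; move: (C * Y) => X hX; lia.
rewrite mulnDl leq_add //; first by rewrite leq_pmulr.
rewrite e mulnACA; exact: leq_mul.
Qed.
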